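(* Let $(f,g)$ be a Jacobian pair, $\xi$ a generic element of $\mathbb K$, $f_\xi=f-\xi$. Then $$\operatorname{I}(f_\xi,g)=-\sum_{\sigma\in P_M}|D^{f_\xi}_\sigma|\,\lambda^g_\sigma=\frac{\deg_yg}{\deg_yf+\deg_yg}\sum_{\sigma\in P_M}|D^{f_\xi}_\sigma|\,(1-\delta_\sigma),$$ where for $\sigma\in P_M$ we write $g(\sigma)=g_\sigma(\pi)t^{\lambda^g_\sigma}+(\text{higher order terms in }t)$ with $g_\sigma(\pi)\neq0$.
   Context: $\mathbb K$ is an algebraically closed field of characteristic $0$. A Jacobian pair is a pair $(f,g)$ in $\mathbb K[x,y]$, both monic in $y$, with $f_xg_y-f_yg_x\in\mathbb K^*$. $\operatorname{I}(h_1,h_2)=\deg_x\operatorname{Res}_y(h_1,h_2)$. Put $x=t^{-1}$; for $h\in\mathbb K[x,y]$ write $h(y)=h(t^{-1},y)$, a polynomial in $y$ over the Puiseux field $\mathbb K\ll t\gg$; $\operatorname{ord}$ is the smallest exponent of $t$ with nonzero coefficient; $\pi$ is an indeterminate. A root $\alpha$ of $f_\xi(y)$ in $\mathbb K\ll t\gg$ is major if $\operatorname{ord}g(\alpha)<0$. For a root $\alpha=\sum a_jt^j$ of $f_\xi(y)$, put $\delta=\max\{\operatorname{ord}(\alpha-\beta): g(\beta)=0\}$ and $\sigma_\alpha=\sum_{j<\delta}a_jt^j+\pi t^{\delta}$ (the final $\pi$-root related to $\alpha$), with split order $\delta_{\sigma_\alpha}=\delta$. $P_M$ is the set of all $\sigma_\alpha$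 with $\alpha$ a major root of $f_\xi(y)$ (the final major $\pi$-roots). For such $\sigma=\sum_{j<\delta_\sigma}a_jt^j+\pi t^{\delta_\sigma}$, $D^{f_\xi}_\sigma=\{\alpha: f_\xi(\alpha)=0,\ \operatorname{ord}(\sigma-\alpha)=\delta_\sigma\}$, i.e. the roots of $f_\xi(y)$ of the form $\sum_{j<\delta_\sigma}a_jt^j+ct^{\delta_\sigma}+\cdots$ with $c\in\mathbb K$; $|D^{f_\xi}_\sigma|$ is its cardinality. *)

(* Defs.v *)
From HB Require Import structures.
From mathcomp Require Import all_boot all_order all_algebra.
From mathcomp Require Import finmap.
From mathcomp Require Import boolp classical_sets functions cardinality fsbigop.

Set Implicit Arguments.
Unset Strict Implicit.
Unset Printing Implicit Defensive.
Import Order.TTheory GRing.Theory Num.Theory.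
Local Open Scope classical_set_scope.
Local Open Scope ring_scope.

(* Generalized (Puiseux-type) series in the variable t with coefficients in R:
   a raw series is a map  q : rat |-> coefficient of t^q.                     *)
Definition ser (R : Type) := rat -> R.

Definition is_puiseux (R : nzRingType) (s : ser R) : Prop :=
  exists N : nat, (0 < N)%N /\
  exists m : rat, forall q : rat, s q != 0 -> m <= q /\ (N%:R * q) \is a Num.int.

Section SeriesOps.
Variable R : comNzRingType.

Definition szero : ser R := fun _ => 0.
Definition sone : ser R := fun q => if q == 0 then 1 else 0.
Definition sadd (s u : ser R) : ser R := fun q => s q + u q.
Definition sopp (s : ser R) : ser R := fun q => - s q.
Definition ssub (s u : ser R) : ser R := fun q => s q - u q.
(* Cauchy product; for Puiseux series the sum is finite. *)
Definition smul (s u : ser R) : ser R :=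
  fun q => \sum_(a \in [set: rat]) s a * u (q - a).
Definition spow (s : ser R) (n : nat) : ser R := iter n (smul s) sone.

(* A polynomial c in x, seen as a series in t via x = t^-1:
   the coefficient of t^q is c_{-q} when q is a nonpositive integer. *)
Definition ser_of_xpoly (c : {poly R}) : ser R :=
  fun q => if (q \is a Num.int) && (q <= 0) then c`_(`|numq q|%N) else 0.

(* h(y) := h(t^-1, y) evaluated at y = s, for h in R[x][y]
   (outer variable y, coefficients polynomials in x). *)
Definition seval (h : {poly {poly R}}) (s : ser R) : ser R :=
  \big[sadd/szero]_(i < size h) smul (ser_of_xpoly h`_i) (spow s i).

(* ord: the smallest exponent of t with a nonzero coefficient
   (junk value 0 for the zero series or if no minimum exists). *)
Definition sord (s : ser R) : rat :=
  xget 0 [set q | s q != 0 /\ forall r, r < q -> s r = 0].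

Definition proot (h : {poly {poly R}}) (s : ser R) : Prop :=
  is_puiseux s /\ seval h s = szero.

End SeriesOps.

Section Jacobian.
Variable K : closedFieldType.

(* bivariate polynomials in K[x,y]: {poly {poly K}}, outer variable y *)
Definition dx (h : {poly {poly K}}) : {poly {poly K}} := map_poly deriv h.
Definition dy (h : {poly {poly K}}) : {poly {poly K}} := deriv h.
Definition degy (h : {poly {poly K}}) : nat := (size h).-1.

Definition jacobian_pair (f g : {poly {poly K}}) : Prop :=
  f \is monic /\ g \is monic /\
  exists c : K, c != 0 /\ dx f * dy g - dy f * dx g = (c%:P)%:P.

Definition Iint (h1 h2 : {poly {poly K}}) : nat := (size (resultant h1 h2)).-1.

Definition fxi (f : {poly {poly K}}) (xi : K) : {poly {poly K}} := f - (xi%:P)%:P.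

Definition major (f g : {poly {poly K}}) (alpha : ser K) : Prop :=
  proot f alpha /\ sord (seval g alpha) < 0.

Definition split_order (g : {poly {poly K}}) (alpha : ser K) : rat :=
  xget 0 [set d | (exists beta, proot g beta /\ sord (ssub alpha beta) = d) /\
                  forall beta, proot g beta -> sord (ssub alpha beta) <= d].

(* A final pi-root  sum_{j<delta} a_j t^j + pi t^delta  is represented by the pair
   (truncation sum_{j<delta} a_j t^j , delta). *)
Definition trunc (alpha : ser K) (d : rat) : ser K :=
  fun q => if q < d then alpha q else 0.

(* the pi-root as a series with coefficients in K[pi] = {poly K} *)
Definition pi_ser (sg : ser K * rat) : ser {poly K} :=
  fun q => if q < sg.2 then (sg.1 q)%:P
           else if q == sg.2 then 'X else 0.

Definition final_pi_root (g : {poly {poly K}}) (alpha : ser K) : ser K * rat :=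
  (trunc alpha (split_order g alpha), split_order g alpha).

Definition PM (f g : {poly {poly K}}) : set (ser K * rat) :=
  [set final_pi_root g alpha | alpha in major f g].

Definition Dset (f : {poly {poly K}}) (sg : ser K * rat) : set (ser K) :=
  [set alpha | proot f alpha /\
     sord (ssub (pi_ser sg) (fun q => (alpha q)%:P)) = sg.2].

Definition scard (T : choiceType) (A : set T) : nat := #|` fset_set A|.

Definition lambda (g : {poly {poly K}}) (sg : ser K * rat) : rat :=
  sord (seval (map_poly (map_poly polyC) g) (pi_ser sg)).

End Jacobian.

(* Main.v *)
Require Import Defs.
From HB Require Import structures.
From mathcomp Require Import all_boot all_order all_algebra.
From mathcomp Require Import ring lra.
From mathcomp Require Import finmap.
From mathcomp Require Import boolp classical_sets functions cardinality fsbigop.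
Set Implicit Arguments.
Unset Strict Implicit.
Unset Printing Implicit Defensive.
Import Order.TTheory GRing.Theory Num.Theory.
Local Open Scope classical_set_scope.
Local Open Scope ring_scope.

(** Write f for f_xi, f(y) = prod (y - alpha_i) and g(y) = prod (y - beta_j) over the field of
    Puiseux series in t. Then Res_y(f, g) = prod_j f(beta_j), so that I(f, g) is minus
    the sum of the orders of the g(alpha_i).

    Fix a root alpha of f and let s_d be alpha truncated below t^d plus pi t^d. Then
    f(s_d) = f_d(pi) t^F(d) + ... and g(s_d) = g_d(pi) t^G(d) + ..., where F(d) and G(d)
    are the sums of min(d, ord(alpha - r)) over the roots r of f and of g, and the
    degrees a(d), b(d) of f_d, g_d are the numbers of roots in contact >= d with alpha.
    Applying d/dpi and t d/dt to f(s_d) and g(s_d), the Jacobian condition gives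
    G f_d' g_d - F f_d g_d' = const, with const = 0 unless F + G = d - 1, and
    F + G <= d - 1 always. In particular F b = G a when F + G < d - 1.

    Let D be the split order of alpha. Before D both F and G have slope >= 1, hence
    d - 1 - F - G decreases strictly and is positive there. Genericity of xi forces
    F(D) <= 0, so F < 0 before D and F b = G a says that F / G is constant:
    deg_y(g) F(D) = deg_y(f) G(D), where G(D) = ord g(alpha). If alpha is not major this
    gives ord g(alpha) = 0. If alpha is major, F + G = D - 1 at D: otherwise F b = G a
    would hold slightly beyond D, where b = 0, a > 0 and G < 0. This yields
    ord g(alpha) = deg_y(g) / (deg_y(f) + deg_y(g)) * (D - 1). *)

(** * The ring of Puiseux series *)

(** The shift [M] lets natural indices [k] reach negative exponents, so a Puiseux series becomes a
    sequence over [nat] and least elements exist. *)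
Definition lat_pt (N M k : nat) : rat := (k%:R - M%:R) / N%:R.

Definition on_lattice (R : nzRingType) (N M : nat) (s : ser R) :=
  forall q, s q != 0 -> exists k : nat, q = lat_pt N M k.

Lemma lat_pt_inj N M : (0 < N)%N -> injective (lat_pt N M).
Proof.
move=> N0 i j; rewrite /lat_pt => /(mulIf _) H.
have {}H := H _.
apply/eqP; rewrite -(eqr_nat rat); apply/eqP/(addIr (- M%:R)); apply: H.
by rewrite invr_eq0 pnatr_eq0 -lt0n.
Qed.

Lemma lat_pt_lt N M i j : (0 < N)%N -> (lat_pt N M i < lat_pt N M j) = (i < j)%N.
Proof.
by move=> N0; rewrite /lat_pt ltr_pM2r ?invr_gt0 ?ltr0n // ltrD2r ltr_nat.
Qed.

Lemma lat_ptD N M M' i j : lat_pt N M i + lat_pt N M' j = lat_pt N (M + M') (i + j).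
Proof. by rewrite /lat_pt -mulrDl !natrD opprD addrACA. Qed.

Lemma lat_pt_refine N M d e k : (0 < d)%N ->
  lat_pt N M k = lat_pt (N * d) (M * d + e) (k * d + e).
Proof.
move=> d0; rewrite /lat_pt !natrD opprD addrACA subrr addr0 !natrM -mulrBl.
by rewrite -mulf_div divff ?mulr1 // pnatr_eq0 -lt0n.
Qed.

Section Lattice.
Variable R : comNzRingType.
Implicit Types s u v : ser R.

Lemma on_lattice_refine N M d e s : (0 < d)%N ->
  on_lattice N M s -> on_lattice (N * d) (M * d + e) s.
Proof.
move=> d0 H q /H[k ->]; exists (k * d + e)%N; exact: lat_pt_refine.
Qed.

Lemma is_puiseuxP s :
  is_puiseux s <-> exists N M, (0 < N)%N /\ on_lattice N M s.
Proof.
split=> [[N [N0 [m H]]]|[N [M [N0 H]]]].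
  (* The shift exceeds [|N m|], so [N q + M] is a nonnegative integer at every exponent [q] of the
     support. *)
  exists N, (Num.bound `|N%:R * m|); split=> // q /H[mq /intrP[z Ez]].
  set M := Num.bound _.
  have NR : (0 : rat) < N%:R by rewrite ltr0n.
  have : 0 <= N%:R * q + M%:R.
    have /ltW : `|N%:R * m| < M%:R by apply: archi_boundP.
    rewrite ler_norml => /andP[+ _]; rewrite lerNl => /(le_trans _) H1.
    rewrite -lerBlDr sub0r; apply: (@le_trans _ _ (N%:R * m)).
      by rewrite lerNl; apply: H1.
    by rewrite ler_pM2l.
  rewrite Ez -(intrD _ _ (Posz M)) ler0z; case E : (z + Posz M) => [k|k] // _.
  exists k; rewrite /lat_pt.
  have -> : k%:R = N%:R * q + M%:R :> rat by rewrite Ez -(intrD _ _ (Posz M)) E.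
  by rewrite addrK mulrC mulrA mulVf ?mul1r // lt0r_neq0.
exists N; split=> //; exists (lat_pt N M 0) => q /H[k ->]; split.
  by rewrite /lat_pt ler_pM2r ?invr_gt0 ?ltr0n // lerD2r ler0n.
rewrite /lat_pt mulrC divfK ?pnatr_eq0 -?lt0n //.
by rewrite rpredB ?natr_int.
Qed.

Lemma on_lattice_ext N M s u : on_lattice N M s -> on_lattice N M u ->
  (forall k, s (lat_pt N M k) = u (lat_pt N M k)) -> s = u.
Proof.
move=> Hs Hu E; apply/funext => q.
have [/eqP|/Hs[k ->]//] := boolP (s q == 0).
by have [/eqP -> -> //|/Hu[k ->] //] := boolP (u q == 0).
Qed.

Lemma fsum_seq (r : seq rat) (F : rat -> R) : uniq r ->
  (forall a, F a != 0 -> a \in r) -> \sum_(a \in [set: rat]) F a = \sum_(a <- r) F a.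
Proof.
move=> ur H; rewrite (fsbig_seq _ _ ur); apply/esym/fsbig_widen => //= q [_ /=].
by move=> /negP qr; apply/eqP/negPn; apply: contra qr; apply: H.
Qed.

(** Both supports are indexed by naturals, so only the pairs [i + j = k] contribute and the sum over
    all rationals becomes a finite Cauchy product. *)
Lemma smulE N M M' s u k : (0 < N)%N -> on_lattice N M s -> on_lattice N M' u ->
  smul s u (lat_pt N (M + M') k) =
  \sum_(i < k.+1) s (lat_pt N M i) * u (lat_pt N M' (k - i)).
Proof.
move=> N0 Hs Hu; rewrite /smul.
rewrite (@fsum_seq [seq lat_pt N M i | i <- iota 0 k.+1]) //.
- rewrite big_map -[k.+1]subn0 -/(index_iota 0 k.+1) big_mkord subn0.
  apply: eq_bigr => i _; congr (_ * u _).
  have -> : lat_pt N (M + M') k = lat_pt N M i + lat_pt N M' (k - i).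
    by rewrite lat_ptD subnKC // -ltnS.
  by rewrite addrC addKr.
- by rewrite map_inj_uniq ?iota_uniq //; apply: lat_pt_inj.
move=> a nz; have /Hs[i Ei] : s a != 0.
  by apply: contraNneq nz => ->; rewrite mul0r.
have /Hu[j Ej] : u (lat_pt N (M + M') k - a) != 0.
  by apply: contraNneq nz => ->; rewrite mulr0.
have /lat_pt_inj -> // : lat_pt N (M + M') k = lat_pt N (M + M') (i + j).
  by rewrite -lat_ptD -Ei -Ej addrC subrK.
by rewrite Ei map_f // mem_iota add0n ltnS leq_addr.
Qed.

Lemma on_lattice_mul N M M' s u : on_lattice N M s -> on_lattice N M' u ->
  on_lattice N (M + M') (smul s u).
Proof.
move=> Hs Hu q nz.
have [//|no] := EM (exists k, q = lat_pt N (M + M') k).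
case/eqP: nz; rewrite /smul fsbig1 // => a _; apply/eqP/negPn/negP => nz.
have /Hs[i Ei] : s a != 0 by apply: contraNneq nz => ->; rewrite mul0r.
have /Hu[j Ej] : u (q - a) != 0.
  by apply: contraNneq nz => ->; rewrite mulr0.
by apply: no; exists (i + j)%N; rewrite -lat_ptD -Ei -Ej addrC subrK.
Qed.

Lemma is_puiseux_common s u : is_puiseux s -> is_puiseux u ->
  exists N M, [/\ (0 < N)%N, on_lattice N M s & on_lattice N M u].
Proof.
move=> /is_puiseuxP[N [M [N0 Hs]]] /is_puiseuxP[N' [M' [N0' Hu]]].
(* Each lattice is refined by the other denominator and shifted by the other rescaled origin. *)
exists (N * N')%N, (M * N' + M' * N)%N; split; first by rewrite muln_gt0 N0.
  exact: on_lattice_refine.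
by rewrite mulnC addnC; apply: on_lattice_refine.
Qed.

Lemma is_puiseux_common3 s u v : is_puiseux s -> is_puiseux u -> is_puiseux v ->
  exists N M, [/\ (0 < N)%N, on_lattice N M s, on_lattice N M u & on_lattice N M v].
Proof.
move=> ps pu /is_puiseuxP[N' [M' [N0' Hv]]].
have [N [M [N0 Hs Hu]]] := is_puiseux_common ps pu.
exists (N * N')%N, (M * N' + M' * N)%N; split; first by rewrite muln_gt0 N0.
- exact: on_lattice_refine.
- exact: on_lattice_refine.
by rewrite mulnC addnC; apply: on_lattice_refine.
Qed.

Lemma is_puiseuxD s u : is_puiseux s -> is_puiseux u -> is_puiseux (sadd s u).
Proof.
move=> ps pu; have [N [M [N0 Hs Hu]]] := is_puiseux_common ps pu.
apply/is_puiseuxP; exists N, M; split=> // q; rewrite /sadd.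
by have [->|/Hs //] := eqVneq (s q) 0; rewrite add0r => /Hu.
Qed.

Lemma is_puiseuxN s : is_puiseux s -> is_puiseux (sopp s).
Proof.
move=> /is_puiseuxP[N [M [N0 Hs]]].
by apply/is_puiseuxP; exists N, M; split=> // q; rewrite /sopp oppr_eq0 => /Hs.
Qed.

Lemma is_puiseuxM s u : is_puiseux s -> is_puiseux u -> is_puiseux (smul s u).
Proof.
move=> ps pu; have [N [M [N0 Hs Hu]]] := is_puiseux_common ps pu.
apply/is_puiseuxP; exists N, (M + M)%N; split=> //; exact: on_lattice_mul.
Qed.

Definition smono (r : rat) (c : R) : ser R := fun q => if q == r then c else 0.

Lemma is_puiseux_mono r c : is_puiseux (smono r c).
Proof.
exists `|denq r|%N; split; first by rewrite absz_gt0 denq_neq0.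
exists r => q; rewrite /smono; case: (q =P r) => [-> _|_]; last by rewrite eqxx.
split=> //; rewrite -[r in _ * r]divq_num_den mulrC natr_absz gtr0_norm ?denq_gt0 //.
by rewrite divfK ?intr_eq0 ?denq_neq0 // intr_int.
Qed.

Lemma is_puiseux0 : is_puiseux (@szero R).
Proof. by exists 1%N; split=> //; exists 0 => q; rewrite eqxx. Qed.

Lemma smul_monol r c s : smul (smono r c) s = fun q => c * s (q - r).
Proof.
apply/funext=> q; rewrite /smul (@fsum_seq [:: r]) // ?big_seq1 /smono ?eqxx //.
by move=> a; rewrite inE; case: (a =P r) => // _; rewrite mul0r eqxx.
Qed.

Lemma smulC s u : is_puiseux s -> is_puiseux u -> smul s u = smul u s.
Proof.
move=> ps pu; have [N [M [N0 Hs Hu]]] := is_puiseux_common ps pu.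
apply: on_lattice_ext (on_lattice_mul Hs Hu) (on_lattice_mul Hu Hs) _ => k.
rewrite !smulE // (reindex_inj rev_ord_inj) /=.
by apply: eq_bigr => i _; rewrite mulrC !subSS subKn // -ltnS.
Qed.

Lemma smulDl s u v : is_puiseux s -> is_puiseux u -> is_puiseux v ->
  smul (sadd s u) v = sadd (smul s v) (smul u v).
Proof.
move=> ps pu pv; have [N [M [N0 Hs Hu Hv]]] := is_puiseux_common3 ps pu pv.
have Hsu : on_lattice N M (sadd s u).
  by move=> q; rewrite /sadd; have [->|/Hs //] := eqVneq (s q) 0; rewrite add0r => /Hu.
have H : on_lattice N (M + M) (sadd (smul s v) (smul u v)).
  move=> q; rewrite /sadd; have [->|/(on_lattice_mul Hs Hv) //] := eqVneq (smul s v q) 0.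
  by rewrite add0r => /(on_lattice_mul Hu Hv).
apply: on_lattice_ext (on_lattice_mul Hsu Hv) H _ => k.
rewrite {2}/sadd !smulE // -big_split; apply: eq_bigr => i _.
by rewrite /sadd mulrDl.
Qed.

Lemma smulA s u v : is_puiseux s -> is_puiseux u -> is_puiseux v ->
  smul s (smul u v) = smul (smul s u) v.
Proof.
move=> ps pu pv; have [N [M [N0 Hs Hu Hv]]] := is_puiseux_common3 ps pu pv.
have Hl := on_lattice_mul Hs (on_lattice_mul Hu Hv).
have Hr := on_lattice_mul (on_lattice_mul Hs Hu) Hv.
rewrite -addnA in Hr.
apply: on_lattice_ext Hl Hr _ => k.
rewrite smulE //; last exact: on_lattice_mul.
rewrite addnA smulE //; last exact: on_lattice_mul.
(* Associativity is borrowed from [{poly R}]: the coefficient of index [k] in a product involves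
   only indices up to [k], so cutting off there changes nothing. *)
pose P w := \poly_(i < k.+1) w (lat_pt N M i) : {poly R}.
transitivity ((P s * (P u * P v))`_k).
  rewrite coefM; apply: eq_bigr => i _; rewrite coef_poly ltn_ord smulE //.
  congr (_ * _); rewrite coefM; apply: eq_bigr => j _; rewrite !coef_poly.
  have lt1 : (j < k.+1)%N by rewrite (leq_trans (ltn_ord j)) // ltnS leq_subr.
  by rewrite lt1 ltnS (leq_trans (leq_subr _ _)) ?leq_subr.
rewrite mulrA coefM; apply: eq_bigr => i _; rewrite [(P v)`_ _]coef_poly ltnS leq_subr smulE //.
congr (_ * _); rewrite coefM; apply: eq_bigr => j _; rewrite !coef_poly.
have lt1 : (j < k.+1)%N by rewrite (leq_trans (ltn_ord j)) // ltn_ord.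
by rewrite lt1 (leq_ltn_trans (leq_subr _ _)) // ltn_ord.
Qed.

End Lattice.

(** The boolean form of [is_puiseux] makes this a subtype with proof-irrelevant equality, which can
    then carry a ring structure. *)
Record puis (R : comNzRingType) := Puis {pval :> rat -> R; _ : `[< is_puiseux pval >]}.
HB.instance Definition _ (R : comNzRingType) := [isSub for @pval R].
HB.instance Definition _ (R : comNzRingType) := [Choice of puis R by <:].

Section PuisRing.
Variable R : comNzRingType.
Implicit Types s u v : puis R.

Lemma puisP s : is_puiseux s.
Proof. by case: s => v pv; apply/asboolP. Qed.

Definition mk_puis (s : ser R) (h : is_puiseux s) : puis R := Puis (introT (asboolP _) h).

Lemma puis_ext s u : (forall q, s q = u q) -> s = u.
Proof. by move=> E; apply: val_inj; apply/funext. Qed.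

Definition puis0 := mk_puis (is_puiseux0 R).
Definition mono r (c : R) := mk_puis (is_puiseux_mono r c).
Definition puis_add s u := mk_puis (is_puiseuxD (puisP s) (puisP u)).
Definition puis_opp s := mk_puis (is_puiseuxN (puisP s)).
Definition puis_mul s u := mk_puis (is_puiseuxM (puisP s) (puisP u)).

Lemma puis_addA : associative puis_add.
Proof. by move=> s u v; apply: puis_ext => q; apply: addrA. Qed.
Lemma puis_addC : commutative puis_add.
Proof. by move=> s u; apply: puis_ext => q; apply: addrC. Qed.
Lemma puis_add0 : left_id puis0 puis_add.
Proof. by move=> s; apply: puis_ext => q; apply: add0r. Qed.
Lemma puis_addN : left_inverse puis0 puis_opp puis_add.
Proof. by move=> s; apply: puis_ext => q; apply: addNr. Qed.
HB.instance Definition _ := GRing.isZmodule.Build (puis R)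
  puis_addA puis_addC puis_add0 puis_addN.

Lemma puis_mulA : associative puis_mul.
Proof. by move=> s u v; apply: val_inj; apply: smulA; apply: puisP. Qed.
Lemma puis_mulC : commutative puis_mul.
Proof. by move=> s u; apply: val_inj; apply: smulC; apply: puisP. Qed.
Lemma puis_mul1 : left_id (mono 0 1) puis_mul.
Proof.
move=> s; apply: puis_ext => q /=; rewrite smul_monol mul1r subr0 //.
Qed.
Lemma puis_mulDl : left_distributive puis_mul +%R.
Proof. by move=> s u v; apply: val_inj; apply: smulDl; apply: puisP. Qed.
Lemma puis_1neq0 : mono 0 1 != 0.
Proof.
by apply/eqP => /(congr1 (fun s : puis R => s 0)) /eqP; rewrite /= /smono eqxx oner_eq0.
Qed.
HB.instance Definition _ := GRing.Zmodule_isComNzRing.Build (puis R)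
  puis_mulA puis_mulC puis_mul1 puis_mulDl puis_1neq0.

Lemma puisD s u q : (s + u) q = s q + u q. Proof. by []. Qed.
Lemma puisN s q : (- s) q = - s q. Proof. by []. Qed.
Lemma puisB s u q : (s - u) q = s q - u q. Proof. by []. Qed.
Lemma puis0E q : (0 : puis R) q = 0. Proof. by []. Qed.
Lemma monoE r c q : mono r c q = if q == r then c else 0. Proof. by []. Qed.
Lemma puis_monol r c s q : (mono r c * s) q = c * s (q - r).
Proof. by rewrite /GRing.mul /= smul_monol. Qed.

Lemma puis_sum (I : Type) (r : seq I) (P : pred I) (F : I -> puis R) q :
  (\sum_(i <- r | P i) F i) q = \sum_(i <- r | P i) F i q.
Proof. by apply: (big_morph (fun s : puis R => s q)). Qed.

Lemma monoM r r' c c' : mono r c * mono r' c' = mono (r + r') (c * c').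
Proof.
apply: puis_ext => q; rewrite puis_monol !monoE subr_eq addrC.
by case: eqP; rewrite // mulr0.
Qed.

Lemma mono_exp r c n : mono r c ^+ n = mono (r *+ n) (c ^+ n).
Proof.
elim: n => [|n IH]; first by rewrite !expr0 mulr0n.
by rewrite !exprS IH monoM mulrS.
Qed.

Definition pcst : R -> puis R := mono 0.
Fact pcst_zmod : zmod_morphism pcst.
Proof.
by move=> a b; apply: puis_ext => q; rewrite puisB !monoE; case: eqP; rewrite ?subr0.
Qed.
Fact pcst_monoid : monoid_morphism pcst.
Proof. by split=> // a b; rewrite /pcst monoM addr0. Qed.
HB.instance Definition _ := GRing.isZmodMorphism.Build R (puis R) pcst pcst_zmod.
HB.instance Definition _ := GRing.isMonoidMorphism.Build R (puis R) pcst pcst_monoid.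

(** The substitution [x = t^-1] as a ring morphism, so that identities in [K[x,y]] transfer to
    series. *)
Definition xpuis : {rmorphism {poly R} -> puis R} :=
  horner_eval (mono (-1) 1) \o map_poly pcst.

Lemma xpuisE (c : {poly R}) : xpuis c = ser_of_xpoly c :> ser R.
Proof.
apply/funext => q; rewrite /xpuis /= /horner_eval /= (@horner_coef_wide _ (size c)); last first.
  exact: size_poly.
rewrite puis_sum /ser_of_xpoly.
have E i : ((map_poly pcst c)`_i * mono (-1) 1 ^+ i) q = if q == - i%:R then c`_i else 0.
  rewrite coef_map mono_exp expr1n -[X in X * _]/(mono 0 c`_i).
  by rewrite monoM mulr1 add0r monoE mulNrn.
under eq_bigr => i _ do rewrite E.
move=> {E}.
case: ifP => [/andP[/intrP[z ->]] | H].
  rewrite lerz0; case: z => [[|n]|n] // _.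
  - rewrite numq_int /=; have [s0|s0] := posnP (size c).
      move/eqP: s0; rewrite size_poly_eq0 => /eqP ->.
      by rewrite big1 ?coef0 // => i _; rewrite coef0; case: ifP.
    rewrite (bigD1 (Ordinal s0)) //= big1 ?addr0 // => i.
    case: ifP => //; rewrite mulr0z eq_sym oppr_eq0 pnatr_eq0 => /eqP i0 /eqP[].
    exact: val_inj.
  have NE : (Negz n)%:~R = - n.+1%:R :> rat by rewrite NegzE mulrNz.
  rewrite numq_int /=; case: (ltnP n.+1 (size c)) => [lt|ge].
    rewrite NE (bigD1 (Ordinal lt)) //= eqxx big1 ?addr0 // => i.
    by rewrite -val_eqE /= eqr_opp eqr_nat eq_sym => /negPf->.
  rewrite nth_default // big1 // => i _.
  by rewrite NE eqr_opp eqr_nat gtn_eqF // (leq_trans (ltn_ord i)).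
rewrite big1 // => i _; case: eqP => // E; move: H.
by rewrite E rpredN natr_int oppr_le0 ler0n.
Qed.

(** Bridge from evaluation of raw series to [horner] in the ring [puis R], where factorizations into
    roots make sense. *)
Lemma sevalE (h : {poly {poly R}}) s : seval h s = (map_poly xpuis h).[s] :> ser R.
Proof.
rewrite (@horner_coef_wide _ (size h)); last exact: size_poly.
rewrite /seval; have spowE n : spow s n = s ^+ n :> ser R.
  by elim: n => [|n IH] //; rewrite exprS /spow iterS -/(spow s n) IH.
elim/big_rec2: _ => [//|i x y _ E].
by rewrite E spowE coef_map -xpuisE.
Qed.

Lemma proot_puis (h : {poly {poly R}}) s : proot h s <-> root (map_poly xpuis h) s.
Proof.
split=> [[_ E]|/rootP E].
  by apply/rootP/val_inj; rewrite /= -sevalE E.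
by split; [exact: puisP|rewrite sevalE E].
Qed.

Lemma proot_lift (h : {poly {poly R}}) (a : ser R) : proot h a ->
  exists2 s : puis R, a = s & root (map_poly xpuis h) s.
Proof. by move=> pa; exists (mk_puis pa.1) => //; apply/proot_puis. Qed.

End PuisRing.

(** * Leading terms and Hensel lifting *)

Section Lead.
Variable R : comNzRingType.
Implicit Types (s u : puis R) (q r : rat) (c d : R).

(* The coefficient [c] may vanish: this says s = c t^q + (terms of order > q). *)
Definition has_lead s q c := s q = c /\ forall r, r < q -> s r = 0.

Lemma puisM s u q : (s * u) q = \sum_(a \in [set: rat]) s a * u (q - a).
Proof. by []. Qed.

Lemma has_leadM s u q r c d : has_lead s q c -> has_lead u r d ->
  has_lead (s * u) (q + r) (c * d).
Proof.
move=> [sq s0] [ur u0]; split=> [|x lt].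
  rewrite puisM (@fsum_seq _ [:: q]) ?big_seq1 //.
    by rewrite sq addrC addKr ur.
  move=> a nz; rewrite inE; case: (ltgtP a q) => // h; case/eqP: nz.
    by rewrite s0 ?mul0r.
  by rewrite u0 ?mulr0 // ltrBlDr [q + r]addrC ltrD2l.
rewrite puisM fsbig1 // => a _; case: (ltP a q) => h; first by rewrite s0 ?mul0r.
by rewrite u0 ?mulr0 // ltrBlDr (lt_le_trans lt) // addrC lerD2l.
Qed.

Lemma has_lead1 : has_lead 1 0 1.
Proof. by split=> [|r r0]; rewrite [1]/(mono 0 1) monoE ?eqxx // lt_eqF. Qed.

Lemma has_lead_prod (I : eqType) (l : seq I) (F : I -> puis R) Q C :
  (forall i, i \in l -> has_lead (F i) (Q i) (C i)) ->
  has_lead (\prod_(i <- l) F i) (\sum_(i <- l) Q i) (\prod_(i <- l) C i).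
Proof.
elim: l => [|i l IH] H; first by rewrite !big_nil; apply: has_lead1.
rewrite !big_cons; apply: has_leadM; first by apply: H; rewrite mem_head.
by apply: IH => j jl; apply: H; rewrite inE jl orbT.
Qed.

(** The support lies on a lattice indexed by naturals, so a least index with nonzero coefficient
    exists. *)
Lemma has_lead_exists s : s != 0 -> exists q, s q != 0 /\ has_lead s q (s q).
Proof.
move=> nz; have /is_puiseuxP[N [M [N0 H]]] := puisP s.
have ex : exists k, s (lat_pt N M k) != 0.
  apply: contrapT => no; move/eqP: nz; apply; apply: puis_ext => q.
  apply/eqP/negPn/negP => nq.
  by have [k Ek] := H _ nq; apply: no; exists k; rewrite -Ek.
have [k nzk mink] := ex_minnP ex.
exists (lat_pt N M k); split=> //; split=> // r lt; apply/eqP/negPn/negP => nzr.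
have [j Ej] := H _ nzr; move: lt; rewrite Ej lat_pt_lt // ltnNge.
by rewrite mink // -Ej.
Qed.

Lemma has_lead_sord (s : puis R) q c : has_lead s q c -> c != 0 -> sord s = q.
Proof.
move=> [sq s0] nz; apply: xget_unique; first by split=> //; rewrite sq.
move=> y [ny y0]; apply/eqP; case: ltgtP => // h.
  by rewrite s0 ?eqxx in ny.
by move: nz; rewrite -sq y0 ?eqxx.
Qed.

Lemma sord_lead s : s != 0 -> s (sord s) != 0 /\ has_lead s (sord s) (s (sord s)).
Proof.
by move=> /has_lead_exists[q [nz h]]; rewrite (has_lead_sord h nz).
Qed.

End Lead.

Section UnitRing.
Variable R : comNzRingType.
Implicit Types s u : puis R.

(** Units and inverses are taken by choice; they only serve to reach the integral domain structure,
    which is built over unit rings. *)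
Definition puis_unit : pred (puis R) := fun s => `[< exists u, u * s = 1 >].
Definition puis_inv s : puis R :=
  match pselect (exists u, u * s = 1) with left h => projT1 (cid h) | _ => s end.
Lemma puis_mulV : {in puis_unit, left_inverse 1 puis_inv *%R}.
Proof. by move=> s /asboolP h; rewrite /puis_inv; case: pselect => // h'; case: cid. Qed.
Lemma puis_unitP s u : u * s = 1 -> puis_unit s.
Proof. by move=> h; apply/asboolP; exists u. Qed.
Lemma puis_inv_out : {in [predC puis_unit], puis_inv =1 id}.
Proof.
by move=> s; rewrite inE => /asboolPn h; rewrite /puis_inv; case: pselect.
Qed.
HB.instance Definition _ := GRing.ComNzRing_hasMulInverse.Build (puis R)
  puis_mulV puis_unitP puis_inv_out.
End UnitRing.

Lemma puis_integral (R : idomainType) : GRing.integral_domain_axiom (puis R).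
Proof.
move=> s u E; apply/negPn/negP; rewrite negb_or => /andP[].
move=> /has_lead_exists[q [nq hq]] /has_lead_exists[r [nr hr]].
have [] := has_leadM hq hr; rewrite E puis0E => /esym/eqP.
by rewrite mulf_eq0 (negPf nq) (negPf nr).
Qed.
HB.instance Definition _ (R : idomainType) :=
  GRing.ComUnitRing_isIntegral.Build (puis R) (@puis_integral R).

(** * Maps acting coefficient by coefficient *)

Section CoefMap.
Variables R R' : comNzRingType.
Implicit Types s u : puis R.

Lemma coef_map_puiseux (phi : rat -> R -> R') (phi0 : forall q, phi q 0 = 0) s :
  is_puiseux (fun q => phi q (s q)).
Proof.
have /is_puiseuxP[N [M [N0 H]]] := puisP s.
apply/is_puiseuxP; exists N, M; split=> // q nz; apply: H.
by apply: contraNneq nz => ->; rewrite phi0.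
Qed.

(** Letting [phi] depend on the exponent covers truncation and [t d/dt] as well as [d/dpi] and
    changes of the coefficient ring. *)
Definition coef_map_puis phi phi0 s := mk_puis (@coef_map_puiseux phi phi0 s).

Lemma coef_map_lattice phi phi0 s N M : on_lattice N M s ->
  on_lattice N M (@coef_map_puis phi phi0 s).
Proof. by move=> H q nz; apply: H; apply: contraNneq nz => /= ->; rewrite phi0. Qed.

End CoefMap.

Lemma coef_map_leibniz (R : comNzRingType) (phi : rat -> R -> R)
    (phi0 : forall q, phi q 0 = 0) :
  (forall q, {morph phi q : c d / c + d}) ->
  (forall q r c d, phi (q + r) (c * d) = phi q c * d + c * phi r d) ->
  forall s u : puis R, coef_map_puis phi0 (s * u) =
    coef_map_puis phi0 s * u + s * coef_map_puis phi0 u.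
Proof.
move=> phiD phiM s u; set D := coef_map_puis phi0.
have [N [M [N0 Hs Hu]]] := is_puiseux_common (puisP s) (puisP u).
have HDs : on_lattice N M (D s) by apply: coef_map_lattice.
have HDu : on_lattice N M (D u) by apply: coef_map_lattice.
apply: val_inj; apply: (@on_lattice_ext _ N (M + M)).
- exact: (@coef_map_lattice _ _ _ _ (s * u) _ _ (on_lattice_mul Hs Hu)).
- move=> q; rewrite /= /sadd.
  have [->|/(on_lattice_mul HDs Hu) //] := eqVneq (smul (D s) u q) 0.
  by rewrite add0r => /(on_lattice_mul Hs HDu).
move=> k; rewrite /= /sadd !smulE // -big_split /=.
rewrite (@big_morph _ _ (phi _) 0 +%R) //; apply: eq_bigr => i _.
have -> : lat_pt N (M + M) k = lat_pt N M i + lat_pt N M (k - i).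
  by rewrite lat_ptD subnKC // -ltnS.
by rewrite phiM.
Qed.

Section Lift.
Variables (R R' : comNzRingType) (f : {rmorphism R -> R'}).

Definition puis_lift : puis R -> puis R' :=
  @coef_map_puis R R' (fun _ c => f c) (fun _ => rmorph0 f).

Lemma puis_liftE s q : puis_lift s q = f (s q). Proof. by []. Qed.

Fact puis_lift_zmod : zmod_morphism puis_lift.
Proof. by move=> s u; apply: puis_ext => q; rewrite puisB !puis_liftE rmorphB. Qed.

Fact puis_lift_monoid : monoid_morphism puis_lift.
Proof.
split=> [|s u].
  apply: puis_ext => q; rewrite puis_liftE !monoE.
  by case: (q =P 0) => _; rewrite ?rmorph1 ?rmorph0.
have [N [M [N0 Hs Hu]]] := is_puiseux_common (puisP s) (puisP u).
have Hs' : on_lattice N M (puis_lift s) by apply: coef_map_lattice.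
have Hu' : on_lattice N M (puis_lift u) by apply: coef_map_lattice.
apply: val_inj; apply: (@on_lattice_ext _ N (M + M)).
- exact: (@coef_map_lattice _ _ _ _ (s * u) _ _ (on_lattice_mul Hs Hu)).
- exact: on_lattice_mul.
move=> k; rewrite /= !smulE // rmorph_sum; apply: eq_bigr => i _.
by rewrite rmorphM.
Qed.
HB.instance Definition _ := GRing.isZmodMorphism.Build _ _ puis_lift puis_lift_zmod.
HB.instance Definition _ := GRing.isMonoidMorphism.Build _ _ puis_lift puis_lift_monoid.

Lemma puis_lift_mono r c : puis_lift (mono r c) = mono r (f c).
Proof. by apply: puis_ext => q; rewrite puis_liftE !monoE; case: eqP; rewrite ?rmorph0. Qed.

Lemma puis_lift_xpuis (c : {poly R}) : puis_lift (xpuis R c) = xpuis R' (map_poly f c).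
Proof.
rewrite /xpuis /= /horner_eval /= -horner_map /= puis_lift_mono rmorph1.
congr (_.[_]); rewrite -!map_poly_comp; apply: eq_map_poly => a /=.
exact: puis_lift_mono.
Qed.

End Lift.

(** * Hensel lifting *)

Section LatticeSeries.
Variables (R : comNzRingType) (n : nat).

(** This is the sum of the [a k t^(k/(n+1))]. [truncn] recovers the index, and the equality test
    discards exponents off the lattice, negative ones included. *)
Definition lat_ser (a : nat -> R) : ser R := fun q =>
  let k := Num.truncn (n.+1%:R * q) in if q == lat_pt n.+1 0 k then a k else 0.

Lemma lat_ser_lattice a : on_lattice n.+1 0 (lat_ser a).
Proof.
move=> q; rewrite /lat_ser /=; case: (q =P lat_pt _ _ _) => [-> _|]; last by rewrite eqxx.
by eexists.
Qed.

Lemma lat_ser_puiseux a : is_puiseux (lat_ser a).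
Proof. by apply/is_puiseuxP; exists n.+1, 0%N; split=> //; apply: lat_ser_lattice. Qed.

Definition lat_puis a := mk_puis (lat_ser_puiseux a).

Lemma lat_puisE a k : lat_puis a (lat_pt n.+1 0 k) = a k.
Proof.
have E : Num.truncn (n.+1%:R * lat_pt n.+1 0 k) = k.
  by rewrite /lat_pt subr0 mulrC divfK ?pnatr_eq0 // natrK.
by rewrite /= /lat_ser E eqxx.
Qed.

Lemma lat_puis_ext (s u : puis R) : on_lattice n.+1 0 s -> on_lattice n.+1 0 u ->
  (forall k, s (lat_pt n.+1 0 k) = u (lat_pt n.+1 0 k)) -> s = u.
Proof. by move=> Hs Hu E; apply: val_inj; apply: on_lattice_ext Hs Hu E. Qed.

Lemma lat_puisME a b k : (lat_puis a * lat_puis b) (lat_pt n.+1 0 k) =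
  \sum_(i < k.+1) a i * b (k - i)%N.
Proof.
transitivity (smul (lat_puis a) (lat_puis b) (lat_pt n.+1 (0 + 0) k)); first by [].
rewrite smulE //; try exact: lat_ser_lattice.
by apply: eq_bigr => i _; rewrite !lat_puisE.
Qed.

Lemma lattice_sum (I : Type) (r : seq I) (P : pred I) (F : I -> puis R) :
  (forall i, P i -> on_lattice n.+1 0 (F i)) ->
  on_lattice n.+1 0 (\sum_(i <- r | P i) F i : puis R).
Proof.
move=> H; elim/big_rec: _ => [q|i s Pi Hs q]; first by rewrite eqxx.
by rewrite puisD; have [->|/(H _ Pi) //] := eqVneq (F i q) 0; rewrite add0r => /Hs.
Qed.

End LatticeSeries.

Section HenselSeq.
Variable K : fieldType.
Variables (P : nat -> {poly K}) (A0 B0 : {poly K}).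
Hypotheses (mA : A0 \is monic) (mB : B0 \is monic) (cop : coprimep A0 B0).
Hypotheses (P0 : P 0%N = A0 * B0) (szP : forall k, (size (P k.+1) < size (P 0%N))%N).

(** Multiply a Bezout relation by [p] and reduce the cofactor of [B0] modulo [A0]; the bound on [p]
    then bounds the other cofactor. This is the linear equation solved at each step of the
    lifting. *)
Lemma hensel_solve (p : {poly K}) : (size p < size (A0 * B0)%R)%N ->
  exists ab : {poly K} * {poly K},
  [/\ (size ab.1 < size A0)%N, (size ab.2 < size B0)%N & p = A0 * ab.2 + ab.1 * B0].
Proof.
have A0n := monic_neq0 mA; have B0n := monic_neq0 mB.
move=> szp; have /Bezout_eq1_coprimepP[[u v] /= uv] := cop.
pose a := (p * v) %% A0.
have sa : (size a < size A0)%N by rewrite ltn_modp.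
have dv : A0 %| p - a * B0.
  have -> : p - a * B0 = A0 * (p * u + (p * v) %/ A0 * B0).
    have Ea : p * v = (p * v) %/ A0 * A0 + a := divp_eq (p * v) A0.
    have Ep : p = p * u * A0 + p * v * B0 by rewrite -{1}[p]mulr1 -uv; ring.
    by rewrite {1}Ep {1}Ea; ring.
  by rewrite dvdp_mulr.
have Eb := divpK dv; set b := (p - a * B0) %/ A0 in Eb.
exists (a, b); split=> //=; last by rewrite mulrC Eb subrK.
have : (size (b * A0)%R < size (A0 * B0)%R)%N.
  rewrite Eb; apply: leq_ltn_trans (size_polyD _ _) _.
  rewrite gtn_max szp size_polyN /=.
  have [->|an] := eqVneq a 0; first by rewrite mul0r size_poly0 size_poly_gt0 mulf_neq0.
  rewrite !size_mul //; have : (0 < size B0)%N by rewrite size_poly_gt0.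
  by case: (size B0) => // m _; rewrite !addnS /= ltn_add2r.
have [->|bn] := eqVneq b 0; first by rewrite size_poly0 size_poly_gt0.
rewrite !size_mul // [(size A0 + _)%N]addnC.
have : (0 < size A0)%N by rewrite size_poly_gt0.
by case: (size A0) => // m _; rewrite !addnS /= ltn_add2r.
Qed.

Lemma hensel_seq : exists A B : nat -> {poly K},
  [/\ A 0%N = A0, B 0%N = B0,
      (forall k, size (A k.+1) < size A0)%N, (forall k, size (B k.+1) < size B0)%N &
      forall k, P k = \sum_(i < k.+1) A i * B (k - i)%N].
Proof.
have A0n := monic_neq0 mA; have B0n := monic_neq0 mB.
have /choice[sol Hsol] : forall p : {poly K}, exists ab : {poly K} * {poly K},
    (size p < size (A0 * B0)%R)%N ->
    [/\ (size ab.1 < size A0)%N, (size ab.2 < size B0)%N & p = A0 * ab.2 + ab.1 * B0].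
  move=> p; have [/hensel_solve[ab H]|h] := boolP (size p < size (A0 * B0)%R)%N; first by exists ab.
  by exists 0.
(* The correction at [k + 1] depends on all earlier ones, so the recursion carries the whole list.
   The subtracted products are those whose two indices are both positive. *)
pose rhs k (l : seq ({poly K} * {poly K})) :=
  P k.+1 - \sum_(i < k) (nth 0 l i.+1).1 * (nth 0 l (k - i)).2.
pose hs := fix hs k := if k is k'.+1 then rcons (hs k') (sol (rhs k' (hs k')))
  else [:: (A0, B0)].
have size_hs k : size (hs k) = k.+1 by elim: k => //= k IH; rewrite size_rcons IH.
have stable k i : (i <= k)%N -> nth 0 (hs k) i = nth 0 (hs i) i.
  elim: k => [|k IH]; first by rewrite leqn0 => /eqP ->.
  rewrite leq_eqVlt => /orP[/eqP ->//|]; rewrite ltnS => ik /=.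
  by rewrite nth_rcons size_hs ltnS ik IH.
pose A k := (nth 0 (hs k) k).1; pose B k := (nth 0 (hs k) k).2.
pose rk k := P k.+1 - \sum_(i < k) A i.+1 * B (k - i)%N.
have step k : (A k.+1, B k.+1) = sol (rk k).
  rewrite /A /B /= nth_rcons size_hs ltnn eqxx -surjective_pairing /rhs /rk.
  congr (sol (_ - _)); apply: eq_bigr => i _.
  by rewrite !stable // leq_subr.
have key k : [/\ (size (A k.+1) < size A0)%N, (size (B k.+1) < size B0)%N &
    rk k = A0 * B k.+1 + A k.+1 * B0].
  elim/ltn_ind: k => k IH.
  have [] := Hsol (rk k); last by rewrite -step.
  rewrite /rk; apply: leq_ltn_trans (size_polyD _ _) _.
  rewrite gtn_max -P0 szP size_polyN P0 /=.
  apply: leq_ltn_trans (size_sum _ _ _) _.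
  have sAB : (0 < size (A0 * B0)%R)%N by rewrite size_poly_gt0 mulf_neq0.
  rewrite -[X in (_ < X)%N]prednK // ltnS; apply/bigmax_leqP => i _.
  rewrite -ltnS prednK //.
  have [sA _ _] := IH i (ltn_ord i).
  have ki : (k - i = (k - i.+1).+1)%N by rewrite subnSK.
  have [_ sB _] := IH (k - i.+1)%N ltac:(by rewrite ltn_subrL (leq_ltn_trans _ (ltn_ord i))).
  rewrite ki; apply: leq_ltn_trans (size_polyMleq _ _) _.
  rewrite size_mul //; case: (size A0) sA => // a sA; case: (size B0) sB => // b sB.
  rewrite addSn addnS /= -[X in (_ < X)%N]/((a + b).+1).
  rewrite ltnS; apply: leq_trans (leq_pred _) _.
  by apply: leq_add.
exists A, B; split=> //; [by move=> k; case: (key k)|by move=> k; case: (key k)|].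
case=> [|k]; first by rewrite big_ord_recl big_ord0 addr0.
have [_ _ E] := key k; rewrite big_ord_recl big_ord_recr /= subn0 subnn.
have -> : P k.+1 = rk k + \sum_(i < k) A i.+1 * B (k - i)%N by rewrite /rk subrK.
by rewrite E -addrA; congr (_ + _); rewrite addrC.
Qed.

End HenselSeq.

Section HenselPuis.
Variable K : fieldType.

(** The factorization at [t = 0] is lifted one exponent [k/(n+1)] at a time. The size of [A] is
    recorded because the search for a root goes by induction on the degree. *)
Lemma hensel_puis (n : nat) (p : {poly puis K}) (A0 B0 : {poly K}) :
  p \is monic -> (forall i, on_lattice n.+1 0 (p`_i)) ->
  A0 \is monic -> B0 \is monic -> coprimep A0 B0 ->
  \poly_(i < size p) p`_i 0 = A0 * B0 ->
  exists A B : {poly puis K}, [/\ A \is monic, size A = size A0 & p = A * B].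
Proof.
move=> mp Hp mA mB cop E0.
have A0n := monic_neq0 mA; have B0n := monic_neq0 mB.
have pn := monic_neq0 mp.
have lp0 : lat_pt n.+1 0 0 = 0 by rewrite /lat_pt subrr mul0r.
pose P k := \poly_(i < size p) p`_i (lat_pt n.+1 0 k).
have P0 : P 0%N = A0 * B0 by rewrite -E0 /P lp0.
have szp1 : (size p).-1.+1 = size p by rewrite prednK // size_poly_gt0.
have szP0 : size (P 0%N) = size p.
  apply: size_poly_eq; rewrite -lead_coefE (monicP mp) lp0.
  by rewrite [1]/(mono 0 1) monoE eqxx oner_eq0.
(* As [p] is monic, its leading coefficient contributes to exponent 0 only. *)
have szP k : (size (P k.+1) < size (P 0%N))%N.
  rewrite szP0 -szp1 ltnS; apply/leq_sizeP => j lj; rewrite coef_poly.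
  case: ltnP => // lj2; have -> : j = (size p).-1.
    by apply/eqP; rewrite eqn_leq lj andbT -ltnS szp1.
  rewrite -lead_coefE (monicP mp) [1]/(mono 0 1) monoE.
  by rewrite -lp0 (inj_eq (@lat_pt_inj _ 0 _)).
have [A [B [A_0 B_0 sA sB EP]]] := hensel_seq mA mB cop P0 szP.
have sAk k : (size (A k) <= size A0)%N by case: k => [|k]; rewrite ?A_0 // ltnW.
have sBk k : (size (B k) <= size B0)%N by case: k => [|k]; rewrite ?B_0 // ltnW.
(* Exchange of roles: a sequence of polynomials is reread as a polynomial whose coefficients are
   series. *)
pose C (X : nat -> {poly K}) (m : nat) := \poly_(j < m) lat_puis n (fun k => (X k)`_j).
have CE (X : nat -> {poly K}) m j : (forall k, size (X k) <= m)%N -> (C X m)`_j = lat_puis n (fun k => (X k)`_j).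
  move=> h; rewrite coef_poly; case: ltnP => // mj.
  apply: lat_puis_ext => [q||k]; [by rewrite eqxx|exact: lat_ser_lattice|].
  by rewrite lat_puisE nth_default // (leq_trans (h k)).
exists (C A (size A0)), (C B (size B0)).
have lcA : (C A (size A0))`_(size A0).-1 = 1.
  rewrite CE //; apply: lat_puis_ext; first exact: lat_ser_lattice.
    move=> q; rewrite [1]/(mono 0 1) monoE; case: (q =P 0) => [-> _|]; last by rewrite eqxx.
    by exists 0%N; rewrite lp0.
  move=> k; rewrite lat_puisE [1]/(mono 0 1) monoE -lp0 (inj_eq (@lat_pt_inj _ 0 _)) //.
  case: k => [|k]; first by rewrite A_0 -lead_coefE (monicP mA).
  by rewrite nth_default // -ltnS prednK ?size_poly_gt0.
have sC : size (C A (size A0)) = size A0.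
  apply/eqP; rewrite eqn_leq size_poly /= -[size A0 in X in (X <= _)%N]prednK ?size_poly_gt0 //.
  by rewrite ltnNge; apply/negP => h; move: lcA; rewrite nth_default // => /esym/eqP; rewrite oner_eq0.
split=> //; first by apply/monicP; rewrite lead_coefE sC.
apply/polyP => j; rewrite coefM; apply: (@lat_puis_ext _ n) => //.
  apply: lattice_sum => i _; rewrite !CE //.
  by apply: (@on_lattice_mul _ _ 0 0); apply: lat_ser_lattice.
move=> k; rewrite puis_sum.
transitivity ((P k)`_j).
  rewrite coef_poly; case: ltnP => // h; rewrite nth_default //.
rewrite EP coef_sum.
under eq_bigr => i _ do rewrite coefM.
rewrite exchange_big; apply: eq_bigr => i _.
by rewrite !CE // lat_puisME.
Qed.

End HenselPuis.

(** * The Newton-Puiseux theorem *)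

Lemma coef_XsubC_exp_pred (R : comNzRingType) (c : R) n :
  (('X - c%:P) ^+ n.+1)`_n = - c *+ n.+1.
Proof.
elim: n => [|n IH]; first by rewrite expr1 coefB coefX coefC sub0r.
rewrite exprSr mulrBr coefB coefMX /= coefMC IH.
have := monicP (monic_exp n.+1 (monicXsubC c)).
rewrite lead_coefE size_exp_XsubC /= => ->.
by rewrite mul1r [RHS]mulrSr.
Qed.

Lemma monic_size_le1 (R : nzRingType) (p : {poly R}) :
  p \is monic -> (size p <= 1)%N -> p = 1.
Proof.
move=> /monicP mp sp; have Ep := size1_polyC sp.
by move: mp; rewrite Ep lead_coefC => ->.
Qed.

Section NewtonPuiseux.
Variable K : closedFieldType.
Hypothesis charK0 : [pchar K] =i pred0.

Lemma pnatr_neq0 n : (0 < n)%N -> n%:R != 0 :> K.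
Proof. by move=> n0; have /pcharf0P h := charK0; rewrite h -lt0n. Qed.

Lemma nonneg_lattice (s : puis K) : (forall q, q < 0 -> s q = 0) ->
  exists n, on_lattice n.+1 0 s.
Proof.
move=> Hs; have /is_puiseuxP[[|n] [M [// N0 H]]] := puisP s.
exists n => q nz; have [k Ek] := H _ nz.
have q0 : 0 <= q by rewrite leNgt; apply: contra nz => h; rewrite Hs.
have Mk : (M <= k)%N.
  by move: q0; rewrite Ek /lat_pt pmulr_lge0 ?invr_gt0 ?ltr0n // subr_ge0 ler_nat.
by exists (k - M)%N; rewrite Ek /lat_pt subr0 natrB.
Qed.

Lemma nonneg_lattice_common (F : nat -> puis K) m :
  (forall i q, q < 0 -> F i q = 0) ->
  exists n, forall i, (i < m)%N -> on_lattice n.+1 0 (F i).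
Proof.
move=> HF; elim: m => [|m [n Hn]]; first by exists 0%N.
have [n' Hn'] := nonneg_lattice (HF m).
exists (n.+1 * n'.+1).-1; rewrite prednK ?muln_gt0 // => i.
rewrite ltnS leq_eqVlt => /orP[/eqP ->|im].
  rewrite mulnC -[0%N](addn0 (0 * n.+1)%N).
  exact: on_lattice_refine.
rewrite -[0%N](addn0 (0 * n'.+1)%N); apply: on_lattice_refine => //; exact: Hn.
Qed.

Lemma coprime_split (P : {poly K}) d i0 : P \is monic -> size P = d.+2 ->
  P`_d = 0 -> (i0 <= d)%N -> P`_i0 != 0 ->
  exists A B : {poly K}, [/\ A \is monic, B \is monic, coprimep A B,
    P = A * B & (1 < size A < d.+2)%N].
Proof.
move=> mP szP Pd0 i0d nzi0.
have /closed_rootP[a ra] : size P != 1 by rewrite szP.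
have [m [u /implyP nru EP]] := multiplicity_XsubC P a.
have Pn := monic_neq0 mP.
have {}nru := nru Pn.
have mX : ('X - a%:P) ^+ m \is monic by apply: monic_exp; apply: monicXsubC.
have mu : u \is monic by rewrite -(monicMr u mX) -EP.
have m0 : (0 < m)%N.
  by rewrite lt0n; apply: contraNneq nru => m0; move: ra; rewrite EP m0 expr0 mulr1.
have un := monic_neq0 mu.
have sz : (size u + m = d.+2)%N.
  rewrite -szP EP size_mul ?monic_neq0 // size_exp_XsubC.
  by rewrite addnS.
have su : (1 < size u)%N.
  rewrite ltnNge; apply/negP => su.
  have u1 : u = 1 := monic_size_le1 mu su.
  have Em : m = d.+1 by move: sz; rewrite u1 size_poly1 add1n => -[].
  rewrite u1 mul1r Em in EP.
  move/eqP: Pd0; rewrite EP coef_XsubC_exp_pred -mulr_natr mulf_eq0 (negPf (pnatr_neq0 _)) //.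
  rewrite orbF oppr_eq0 => /eqP a0; case/eqP: nzi0.
  by rewrite EP a0 subr0 coefXn ltn_eqF.
exists (('X - a%:P) ^+ m), u; split=> //.
- by rewrite coprimep_expl // coprimep_sym coprimep_XsubC.
- by rewrite mulrC.
by rewrite size_exp_XsubC -sz -[X in (X < _ + _)%N]add1n ltn_add2r su andbT ltnS.
Qed.

(** Induction on the degree. A shift and a rescaling of the variable by the least Newton slope give
    integral coefficients whose reduction has two coprime factors; Hensel lifting then yields a
    monic factor of smaller degree. *)
Lemma puis_root (p : {poly puis K}) : p \is monic -> (1 < size p)%N ->
  exists s, root p s.
Proof.
move: {2}(size p) (leqnn (size p)) => k; elim: k p => [|k IH] p.
  by rewrite leqn0 => /eqP ->.
move=> szk mp; case E : (size p) => [|[|d]] // _.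
have lcp : p`_d.+1 = 1 by have := monicP mp; rewrite lead_coefE E.
(* Translating by [-c] kills the coefficient of degree [d]; this divides by the degree [d + 1],
   hence uses characteristic 0. The [q i] are the Taylor coefficients at [-c]. *)
pose c : puis K := pcst d.+1%:R^-1 * p`_d.
pose q i := p^`N(i).[- c].
have taylor h : p.[- c + h] = \sum_(i < d.+2) q i * h ^+ i.
  by rewrite nderiv_taylor ?E //; apply: mulrC.
have qlast : q d.+1 = 1.
  rewrite /q (_ : p^`N(d.+1) = 1) ?hornerC //.
  apply/polyP => -[|i]; rewrite coef_nderivn coefC /= ?addn0 ?binn ?mulr1n //.
  by rewrite nth_default ?mul0rn // E !addSn !addnS ltnS ltnS leq_addr.
have qd : q d = 0.
  have -> : q d = p`_d - c *+ d.+1.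
    rewrite /q (_ : p^`N(d) = (p`_d)%:P + 'X *+ d.+1).
      by rewrite hornerD hornerC hornerMn hornerX mulNrn.
    apply/polyP => -[|[|i]]; rewrite coef_nderivn coefD coefMn coefX coefC /=.
    - by rewrite addn0 binn mul0rn addr0.
    - by rewrite addn1 lcp binSn add0r.
    rewrite nth_default ?mul0rn ?addr0 ?mul0rn //.
    by rewrite E !addnS !ltnS leq_addr.
  rewrite /c -mulrnAl -rmorphMn -[_^-1 *+ _]mulr_natr mulVf ?pnatr_neq0 //.
  by rewrite rmorph1 mul1r subrr.
(* If all lower Taylor coefficients vanish, [p] is a pure power and [-c] is its root. *)
have [all0|/existsNP[j0 j0P]] := EM (forall i : 'I_d.+1, q i = 0).
  exists (- c); apply/rootP; rewrite -[- c]addr0 taylor big1 // => i _.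
  have [|] := leqP i d; first by move=> id; rewrite (all0 (Ordinal (id : (i < d.+1)%N))) mul0r.
  by case: (i : nat) => // i' _; rewrite expr0n mulr0.
have {}j0P : q j0 != 0 by apply/eqP.
have [i0 nz0 min0] : exists2 i0 : 'I_d.+1, q i0 != 0 &
    forall i : 'I_d.+1, q i != 0 ->
    sord (q i0) / (d.+1 - i0)%:R <= sord (q i) / (d.+1 - i)%:R.
  by case: (Order.TotalTheory.arg_minP (fun i : 'I_d.+1 => sord (q i) / (d.+1 - i)%:R)
     (P := fun i : 'I_d.+1 => q i != 0) j0P) => i h1 h2; exists i.
set r := sord (q i0) / (d.+1 - i0)%:R in min0.
(* These are the coefficients of [t^(-r(d+1)) p(-c + t^r y)]. Minimality of the slope [r] makes them
   integral, and that of index [i0] has a nonzero constant term. *)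
pose e i := mono (- (r * (d.+1 - i)%:R)) 1 * q i.
have eE i x : e i x = q i (x + r * (d.+1 - i)%:R).
  by rewrite puis_monol mul1r opprK.
have dpos (i : 'I_d.+1) : (0 : rat) < (d.+1 - i)%:R by rewrite ltr0n subn_gt0.
have e_neg i x : (i < d.+2)%N -> x < 0 -> e i x = 0.
  rewrite ltnS leq_eqVlt => /orP[/eqP ->|id] x0.
    by rewrite eE subnn mulr0 addr0 qlast [1]/(mono 0 1) monoE lt_eqF.
  rewrite eE; have [->//|nz] := eqVneq (q i) 0.
  have [_ [_ h]] := sord_lead nz; apply: h.
  have := min0 (Ordinal id) nz; rewrite ler_pdivlMr ?dpos //= => le.
  by apply: lt_le_trans le; rewrite gtrDr.
have e_last : e d.+1 = 1.
  by rewrite /e subnn mulr0 oppr0 qlast mulr1.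
have e_i0 : e i0 0 != 0.
  rewrite eE add0r /r divfK ?lt0r_neq0 ?dpos //.
  by have [] := sord_lead nz0.
have [n Hn] : exists n, forall i, (i < d.+2)%N -> on_lattice n.+1 0 (e i).
  have [|n Hn] := @nonneg_lattice_common (fun i => if (i < d.+2)%N then e i else 0) d.+2.
    by move=> i x x0; case: ifP => // id; apply: e_neg.
  by exists n => i id; have := Hn i id; rewrite id.
pose p' := \poly_(i < d.+2) e i.
have sz' : size p' = d.+2 by apply: size_poly_eq; rewrite e_last oner_eq0.
have m' : p' \is monic.
  by apply/monicP; rewrite lead_coefE sz' coef_poly ltnSn e_last.
have lat' i : on_lattice n.+1 0 (p'`_i).
  by rewrite coef_poly; case: ifP => [/Hn //|_ x]; rewrite eqxx.
pose P := \poly_(i < size p') p'`_i 0.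
have PE i : P`_i = p'`_i 0.
  by rewrite coef_poly; case: ltnP => // h; rewrite nth_default.
have P1 : P`_d.+1 = 1.
  by rewrite PE coef_poly ltnSn e_last [1]/(mono 0 1) monoE eqxx.
have szP : size P = d.+2.
  rewrite /P sz'; apply: size_poly_eq; move: P1; rewrite PE => ->; exact: oner_neq0.
have mP : P \is monic by apply/monicP; rewrite lead_coefE szP.
have Pd : P`_d = 0.
  by rewrite PE coef_poly leqnSn eE qd.
have Pi0 : P`_i0 != 0.
  by rewrite PE coef_poly (leq_trans (ltn_ord i0)).
have [A0 [B0 [mA mB cop EP szA]]] := coprime_split mP szP Pd (ltnSE (ltn_ord i0)) Pi0.
have [A [B [mA' szA' EAB]]] := hensel_puis m' lat' mA mB cop EP.
have /andP[A1 A2] := szA.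
have [s /rootP rs] : exists s, root A s.
  by apply: IH; rewrite ?szA' // -ltnS (leq_trans A2) // -E.
(* The rescaling is undone: [p] at this point is [t^(r(d+1)) p'(s)]. *)
exists (- c + mono r 1 * s); apply/rootP; rewrite taylor.
have : p'.[s] = 0 by rewrite EAB hornerM rs mul0r.
rewrite /p' horner_poly => /(congr1 (fun x => mono (r * d.+1%:R) 1 * x)).
rewrite mulr0 mulr_sumr => E0; rewrite -[RHS]E0; apply: eq_bigr => i _.
have id : (i <= d.+1)%N by rewrite -ltnS.
rewrite exprMn (_ : mono r 1 ^+ i = mono (r * d.+1%:R) 1 * mono (- (r * (d.+1 - i)%:R)) 1); last first.
  rewrite mono_exp expr1n monoM mulr1 natrB // mulrBr opprB addrC subrK.
  by rewrite mulr_natr.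
rewrite /e.
set u := mono (r * _) 1.
set w := mono (- _) 1.
by ring.
Qed.

Lemma puis_split (p : {poly puis K}) : p \is monic ->
  exists rs : seq (puis K), p = \prod_(s <- rs) ('X - s%:P).
Proof.
move: {2}(size p) (leqnn (size p)) => k; elim: k p => [|k IH] p.
  by rewrite leqn0 size_poly_eq0 => /eqP -> /monic_neq0; rewrite eqxx.
move=> szk mp; have [s1|s1] := leqP (size p) 1.
  by exists [::]; rewrite big_nil; apply: monic_size_le1.
have [s /factor_theorem[u Eu]] := puis_root mp s1.
have mu : u \is monic by rewrite -(monicMr u (monicXsubC s)) -Eu.
have [|rs Ers] := IH u _ mu.
  by rewrite -ltnS (leq_trans _ szk) // Eu size_Mmonic ?monic_neq0 ?monicXsubC // size_XsubC addn2.
by exists (s :: rs); rewrite big_cons -Ers mulrC.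
Qed.

End NewtonPuiseux.

(** * The resultant as a product over roots *)

(* Multiply the Sylvester matrix by [V, 0; *, 1], where V is the Vandermonde
   matrix of the roots of q: the product is block triangular. *)
Lemma resultant_prod_roots (R : idomainType) (p : {poly R}) (rs : seq R) :
  uniq rs ->
  resultant p (\prod_(r <- rs) ('X - r%:P)) = \prod_(r <- rs) p.[r].
Proof.
move=> urs; set q := \prod_(r <- rs) _.
have mq : q \is monic by apply: monic_prod_XsubC.
pose n := (size q).-1; pose m := (size p).-1.
have En : n = size rs by rewrite /n size_prod_XsubC.
pose a := \row_(i < n) rs`_i.
pose V : 'M[R]_(n + m) :=
  block_mx (Vandermonde n a) 0 (\matrix_(l < m, i < n) rs`_i ^+ (n + l)) 1%:M.
have szq : size q = n.+1 by rewrite En size_prod_XsubC.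
have szp : (size p <= m.+1)%N by apply: leqSpred.
have Vl (k : 'I_(n + m)) (i : 'I_n) : V k (lshift m i) = rs`_i ^+ k.
  rewrite -(fintype.splitK k); case: (fintype.split k) => j /=.
    by rewrite block_mxEul !mxE.
  by rewrite block_mxEdl !mxE.
have Vr (k : 'I_(n + m)) (l : 'I_m) : V k (rshift n l) = (k == rshift n l)%:R.
  rewrite -(fintype.splitK k); case: (fintype.split k) => j /=.
    by rewrite block_mxEur mxE -val_eqE /= ltn_eqF // ltn_addr.
  by rewrite block_mxEdr !mxE eq_rshift.
have horner_row (u : {poly R}) (k : nat) (x : R) : (k + size u <= n + m)%N ->
    \sum_(j < n + m) (u`_(j - k) *+ (k <= j)) * x ^+ j = x ^+ k * u.[x].
  move=> h; rewrite -[x ^+ k]hornerXn -hornerM (@horner_coef_wide _ (n + m)).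
    by apply: eq_bigr => j _; rewrite coefXnM ltnNge if_neg -mulrb.
  by apply: leq_trans (size_polyMleq _ _) _; rewrite size_polyXn.
pose S := Sylvester_mx p q.
have Sl (k : 'I_n) (j : 'I_(n + m)) : S (lshift m k) j = p`_(j - k) *+ (k <= j).
  by rewrite /S Sylvester_mxE; rewrite (fintype.unsplitK (inl _ k)).
have Sr (k : 'I_m) (j : 'I_(n + m)) : S (rshift n k) j = q`_(j - k) *+ (k <= j).
  by rewrite /S Sylvester_mxE; rewrite (fintype.unsplitK (inr _ k)).
pose D := diag_mx (\row_(i < n) p.[rs`_i]).
pose T := \matrix_(k < m, l < m) (q`_(n + l - k) *+ (k <= n + l)%N).
pose X := \matrix_(k < n, l < m) S (lshift m k) (rshift n l).
have SV : S *m V = block_mx (Vandermonde n a *m D) X 0 T.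
  apply/matrixP => i j; rewrite -(fintype.splitK i) -(fintype.splitK j).
  case: (fintype.split i) => k; case: (fintype.split j) => l /=.
  - rewrite block_mxEul mul_mx_diag !mxE.
    under eq_bigr => t _ do rewrite Sl Vl.
    rewrite horner_row ?mxE //; apply: leq_trans (leq_add _ szp) _; first exact: leqnn.
    by rewrite addnS -addSn leq_add2r.
  - rewrite block_mxEur mxE [RHS]mxE (bigD1 (rshift n l)) //= Vr eqxx mulr1.
    by rewrite big1 ?addr0 // => t ne; rewrite Vr (negPf ne) mulr0.
  - rewrite block_mxEdl !mxE.
    under eq_bigr => t _ do rewrite Sr Vl.
    rewrite horner_row; last by rewrite szq addnS -addSn addnC leq_add2l.
    have /rootP -> : root q rs`_l; last by rewrite mulr0.
    by rewrite root_prod_XsubC mem_nth // -En.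
  rewrite block_mxEdr mxE [RHS]mxE (bigD1 (rshift n l)) //= Vr eqxx mulr1.
  by rewrite big1 ?addr0 ?Sr // => t ne; rewrite Vr (negPf ne) mulr0.
have detT : \det T = 1.
  rewrite det_trig.
    apply: big1 => i _; rewrite mxE addnK leq_addl mulr1n.
    by have := monicP mq; rewrite lead_coefE -/n.
  apply/is_trig_mxP => i j ij; rewrite mxE nth_default ?mul0rn // szq.
  by rewrite -addnBA ?(ltnW ij) // -addn1 leq_add2l subn_gt0.
have detV : \det (Vandermonde n a) != 0.
  rewrite det_Vandermonde; apply/prodf_neq0 => i _; apply/prodf_neq0 => j ij.
  by rewrite !mxE subr_eq0 nth_uniq ?En -?En // gtn_eqF.
have := congr1 determinant SV; rewrite det_mulmx det_lblock det_ublock det_mulmx.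
rewrite det1 detT !mulr1 mulrC => /(mulfI detV).
rewrite -/(resultant p q) => ->; rewrite det_diag.
rewrite (big_nth 0) big_mkord -En; apply: eq_bigr => i _; by rewrite mxE.
Qed.

(** * Sums of truncated contact orders *)

Lemma seq_maxP (s : seq rat) : s != [::] -> exists2 e, e \in s & {in s, forall x, x <= e}.
Proof.
elim: s => // x s IH _; have [->|/IH[e es He]] := eqVneq s [::].
  by exists x; rewrite ?mem_head // => y; rewrite inE => /eqP ->.
case: (leP x e) => h.
  by exists e; rewrite ?inE ?es ?orbT // => y; rewrite inE => /orP[/eqP ->//|/He].
exists x; rewrite ?mem_head // => y; rewrite inE => /orP[/eqP ->//|/He ye].
exact: le_trans ye (ltW h).
Qed.

Section MinSum.
Implicit Types (v w : seq rat) (d e x : rat).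

(** With [v] the list of contact orders, this is the order [F(d)] of the idea above, piecewise
    linear in [d]. The count [nabove v d] is its slope just to the left of [d], and also the degree
    in pi of the leading coefficient. *)
Definition minsum v d : rat := \sum_(x <- v) Num.min d x.
Definition nabove v d : nat := count (fun x => d <= x) v.

Lemma minsum_cons x v d : minsum (x :: v) d = Num.min d x + minsum v d.
Proof. by rewrite /minsum big_cons. Qed.

Lemma minsum_linear v d1 d2 d : d1 <= d <= d2 ->
  (forall x, x \in v -> x <= d1 \/ d2 <= x) -> d1 < d2 ->
  minsum v d = minsum v d1 + (nabove v d2)%:R * (d - d1).
Proof.
move=> /andP[h1 h2] + h12; elim: v => [|x v IH] Hv.
  by rewrite /minsum !big_nil mul0r addr0.
rewrite !minsum_cons IH; last by move=> y yv; apply: Hv; rewrite inE yv orbT.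
rewrite /nabove /= natrD.
case: (Hv x (mem_head _ _)) => hx.
  rewrite !min_r ?(le_trans hx) // leNgt (le_lt_trans hx) //=.
  by rewrite mulrDl mul0r; lra.
have dx : d <= x := le_trans h2 hx.
have d1x : d1 <= x := le_trans h1 dx.
rewrite !min_l //.
by rewrite hx /=; lra.
Qed.

Lemma minsum_above v d : {in v, forall x, d <= x} -> minsum v d = (size v)%:R * d.
Proof.
elim: v => [|x v IH] Hv; first by rewrite /minsum big_nil mul0r.
rewrite minsum_cons IH; last by move=> y yv; apply: Hv; rewrite inE yv orbT.
by rewrite min_l ?Hv ?mem_head // -[X in _ = X * _]natr1 /=; lra.
Qed.

Lemma minsum_below v d : {in v, forall x, x <= d} -> minsum v d = \sum_(x <- v) x.
Proof.
move=> H; rewrite /minsum !big_seq; apply: eq_bigr => x xv.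
by rewrite min_r ?H.
Qed.

Lemma minsum_mono v d e : d <= e -> minsum v d <= minsum v e.
Proof.
move=> de; apply: ler_sum => x _.
by rewrite le_min !ge_min de lexx orbT.
Qed.

Lemma minsum_lipschitz v d e : d <= e -> minsum v e <= minsum v d + (size v)%:R * (e - d).
Proof.
move=> de; elim: v => [|x v IH]; first by rewrite /minsum !big_nil mul0r addr0.
rewrite !minsum_cons /= -natr1.
have : Num.min e x <= Num.min d x + (e - d).
  by case: (leP e x) => h; case: (leP d x) => h'; lra.
lra.
Qed.

(** A single contact value [x >= e] already gives slope at least 1 between [d] and [e]. *)
Lemma minsum_increase v d e x : d <= e -> x \in v -> e <= x ->
  minsum v d + (e - d) <= minsum v e.
Proof.
move=> de; elim: v => // y v IH; rewrite inE !minsum_cons => /orP[/eqP <-|xv] ex.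
  rewrite !min_l ?(le_trans de) //.
  by have := minsum_mono v de; lra.
have := IH xv ex.
have : Num.min d y <= Num.min e y.
  by rewrite le_min !ge_min de lexx orbT.
lra.
Qed.

(** Induction on the number of contact values below [d]. With none, both sums are multiples of [d].
    Otherwise both are linear from the largest such value [e] up to [d], and the hypothesis inside
    this gap makes their slopes proportional to their values. *)
Lemma minsum_proportional v w D :
  (forall d, d < D -> minsum v d < 0) ->
  (forall d, d < D -> minsum v d * (nabove w d)%:R = minsum w d * (nabove v d)%:R) ->
  forall d, d <= D -> (size w)%:R * minsum v d = (size v)%:R * minsum w d.
Proof.
move=> neg H d; move: {2}(count (fun x => x < d) (v ++ w)) (leqnn (count (fun x => x < d) (v ++ w))) => k.
elim: k d => [|k IH] d cnt dD.
  have all_ge x : x \in v ++ w -> d <= x.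
    move: cnt; rewrite leqn0 => /eqP/eqP; rewrite -leqn0 leqNgt -has_count => /hasPn h /h.
    by rewrite -leNgt.
  rewrite !minsum_above; first by rewrite mulrCA.
    by move=> x xw; apply: all_ge; rewrite mem_cat xw orbT.
  by move=> x xv; apply: all_ge; rewrite mem_cat xv.
pose l := [seq x <- v ++ w | x < d].
have [l0|/seq_maxP[e el He]] := eqVneq l [::].
  by apply: IH => //; rewrite -size_filter -/l l0.
move: el; rewrite mem_filter => /andP[ed ev].
have gap x : x \in v ++ w -> x <= e \/ d <= x.
  move=> xv; case: (leP d x) => h; [by right|left].
  by apply: He; rewrite mem_filter h.
have IHe : (size w)%:R * minsum v e = (size v)%:R * minsum w e.
  apply: IH; last exact: le_trans (ltW ed) dD.
  rewrite -ltnS; apply: leq_trans cnt.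
  have sub : subpred (fun x => x < e) (fun x => x < d) by move=> x /lt_trans; apply.
  have /permP p := perm_to_rem ev.
  rewrite !p /= ltxx ed /= add0n add1n ltnS.
  exact: sub_count.
have gapv x : x \in v -> x <= e \/ d <= x by move=> xv; apply: gap; rewrite mem_cat xv.
have gapw x : x \in w -> x <= e \/ d <= x by move=> xv; apply: gap; rewrite mem_cat xv orbT.
(* The hypothesis is only available strictly below [D], while [d = D] is allowed; an interior point
   of the gap has the same slopes as [d]. *)
pose x := (e + d) / 2.
have [ex xd] : e < x /\ x < d by rewrite /x; split; lra.
have cnt_eq u : (forall y, y \in u -> y <= e \/ d <= y) -> nabove u x = nabove u d.
  move=> hu; apply: eq_in_count => y /hu[h|h].
    by rewrite !leNgt (le_lt_trans h) // (le_lt_trans h).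
  by rewrite h (le_trans (ltW xd)).
have := H x (lt_le_trans xd dD); rewrite !cnt_eq //.
have ne := neg e (lt_le_trans ed dD).
have ledd : e <= d <= d by rewrite lexx (ltW ed).
have ledx : e <= x <= d by rewrite !ltW.
rewrite !(minsum_linear ledd) // !(minsum_linear ledx) //.
move: IHe ne; set F := minsum v e; set G := minsum w e.
set a := (nabove v d)%:R; set b := (nabove w d)%:R.
set n := (size w)%:R; set m := (size v)%:R => IHe ne Hx.
(* The linear growth cancels from [Hx], leaving [F b = G a]; then [n F = m G] and [F != 0]
   finish. *)
have E : m * b = n * a.
  apply: (mulfI (lt0r_neq0 (_ : 0 < - F))); first by rewrite oppr_gt0.
  have : F * b = G * a by lra.
  move=> /(congr1 (fun z => m * z)); rewrite !mulrA -IHe; lra.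
by rewrite !mulrDr IHe !mulrA E.
Qed.

End MinSum.

(* The abstract form of the argument: [v] and [w] are the orders of contact of a
   root with the roots of f and g, [D] its split order. The two hypotheses
   [Jle], [Jlt] are what the Jacobian condition says at each truncation order. *)
Section Contact.
Variables (v w : seq rat) (D : rat).
Hypothesis vD : has (fun x => D + 1 <= x) v.
Hypothesis (Dw : D \in w) (wD : {in w, forall x, x <= D}).
Hypothesis Jle : forall d, d <= D + 1 -> minsum v d + minsum w d <= d - 1.
Hypothesis Jlt : forall d, d <= D + 1 -> minsum v d + minsum w d < d - 1 ->
  minsum v d * (nabove w d)%:R = minsum w d * (nabove v d)%:R.

(** Going down from [D], each of the two sums loses at least [D - d], while [d - 1] loses exactly
    that; so [Jle] at [D] becomes strict. *)
Lemma contact_lt d : d < D -> minsum v d + minsum w d < d - 1.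
Proof.
move=> dD; have /hasP[x xv xD] := vD.
have := minsum_increase (ltW dD) xv (le_trans _ xD); rewrite lerDl ler01 => /(_ isT).
have := minsum_increase (ltW dD) Dw (lexx D).
have := Jle (_ : D <= D + 1); rewrite lerDl ler01 => /(_ isT).
lra.
Qed.

Hypothesis F_le0 : minsum v D <= 0.

(** Slope at least 1 and [F_le0] make the sum over [v] negative before [D], and [contact_lt] makes
    [Jlt] applicable there. *)
Lemma contact_proportional : (size w)%:R * minsum v D = (size v)%:R * minsum w D.
Proof.
apply: (@minsum_proportional v w D) => // d dD.
  have /hasP[x xv xD] := vD.
  have := minsum_increase (ltW dD) xv (le_trans _ xD); rewrite lerDl ler01 => /(_ isT).
  by move: F_le0; lra.
apply: Jlt; last exact: contact_lt.
by rewrite (le_trans (ltW dD)) // lerDl ler01.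
Qed.

(* Past D only f still has roots in contact, which contradicts [Jlt]. *)
Lemma contact_eq : minsum w D < 0 -> minsum v D + minsum w D = D - 1.
Proof.
move=> neg; apply/eqP; rewrite eq_le Jle ?lerDl ?ler01 // leNgt; apply/negP => lt.
pose h := D - 1 - (minsum v D + minsum w D).
have h0 : 0 < h by rewrite /h subr_gt0.
(* Small enough that the growth of the sum over [v] does not use up the slack [h], and at most 1 so
   that [Jle] and [Jlt] still apply. The successor avoids a zero denominator. *)
pose e := Num.min 1 (h / (size v).+1%:R).
have e0 : 0 < e by rewrite lt_min ltr01 divr_gt0 ?ltr0n.
have eh : (size v)%:R * e < h.
  apply: (@lt_le_trans _ _ ((size v).+1%:R * e)); first by rewrite ltr_pM2r // ltr_nat.
  by rewrite mulrC -ler_pdivlMr ?ltr0n // ge_min lexx orbT.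
have De : D <= D + e by rewrite lerDl ltW.
have De1 : D + e <= D + 1 by rewrite lerD2l ge_min lexx.
have wE : minsum w (D + e) = minsum w D.
  by rewrite !minsum_below // => x /wD xD; rewrite (le_trans xD).
have := Jlt De1; rewrite wE.
have := minsum_lipschitz v De; rewrite [D + e - D]addrC addKr => lip.
have -> : nabove w (D + e) = 0%N.
  apply/eqP; rewrite -leqn0 leqNgt -has_count; apply/hasPn => x /wD xD.
  by rewrite -ltNge (le_lt_trans xD) // ltrDl.
(* Now [Jlt] reads [0 = G a] with [G < 0], so [a = 0]; but the value at least [D + 1] in [v] is
   still counted. *)
have : minsum v (D + e) + minsum w D < D + e - 1 by move: eh lip; rewrite /h; lra.
move=> /[swap] /[apply]; rewrite mulr0 => /esym/eqP.
rewrite mulf_eq0 lt_eqF //= pnatr_eq0 => /eqP cnt0.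
have /hasP[x xv xD] := vD.
suff : has (fun y => D + e <= y) v by rewrite has_count -/(nabove v (D + e)) cnt0.
by apply/hasP; exists x => //; apply: le_trans De1 xD.
Qed.

End Contact.

(** * The Jacobian condition along a pi-root *)

Lemma coef_top (R : nzRingType) (u v : {poly R}) a b :
  (size u <= a.+1)%N -> (size v <= b.+1)%N -> (u * v)`_(a + b) = u`_a * v`_b.
Proof.
move=> su sv; rewrite coefM.
have lt : (a < (a + b).+1)%N by rewrite ltnS leq_addr.
rewrite (bigD1 (Ordinal lt)) //= addKn big1 ?addr0 // => i.
rewrite -val_eqE /= neq_ltn => /orP[h|h].
  rewrite [v`_ _]nth_default ?mulr0 // (leq_trans sv) //.
  by rewrite ltn_subRL ltn_add2r.
by rewrite nth_default ?mul0r // (leq_trans su).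
Qed.

Section RatEmbedding.
Variable K : fieldType.
Hypothesis charK0 : [pchar K] =i pred0.

(* [ratr] is a ring morphism only on numeric fields *)
Definition ratK (q : rat) : K := (numq q)%:~R / (denq q)%:~R.

Lemma intr_eq0_char0 (z : int) : (z%:~R == 0 :> K) = (z == 0).
Proof.
have /pcharf0P h := charK0.
by case: z => n; rewrite ?NegzE ?mulrNz ?oppr_eq0 -pmulrn h.
Qed.

(** Any fraction representing [q] may be used, which spares reducing sums to lowest terms. *)
Lemma ratKP (q : rat) (z n : int) : n != 0 -> q * n%:~R = z%:~R ->
  ratK q = z%:~R / n%:~R.
Proof.
move=> n0 E; rewrite /ratK; apply/eqP.
rewrite eqr_div ?intr_eq0_char0 ?denq_neq0 // -!intrM -subr_eq0 -intrB intr_eq0_char0 subr_eq0.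
rewrite -(eqr_int rat) !intrM -E [in X in _ == X]mulrAC; apply/eqP; congr (_ * _).
by rewrite -{2}[q]divq_num_den divfK // intr_eq0 denq_neq0.
Qed.

Lemma ratKD p q : ratK (p + q) = ratK p + ratK q.
Proof.
have dp : (denq p)%:~R != 0 :> K by rewrite intr_eq0_char0 denq_neq0.
have dq : (denq q)%:~R != 0 :> K by rewrite intr_eq0_char0 denq_neq0.
rewrite (@ratKP _ (numq p * denq q + numq q * denq p) (denq p * denq q)).
- by rewrite /ratK addf_div // !(intrD, intrM).
- by rewrite mulf_neq0 ?denq_neq0.
rewrite !(intrD, intrM) -{1}[p]divq_num_den -{1}[q]divq_num_den.
by field; rewrite !intr_eq0 !denq_neq0.
Qed.

Lemma ratK_int (z : int) : ratK z%:~R = z%:~R.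
Proof. by rewrite (@ratKP _ z 1) ?mulr1 // divr1. Qed.

Lemma ratKMn q n : ratK (q *+ n) = ratK q *+ n.
Proof.
elim: n => [|n IH]; first by rewrite !mulr0n (ratK_int 0).
by rewrite !mulrS ratKD IH.
Qed.

Lemma ratK_inj : injective ratK.
Proof.
move=> p q E; have := ratKD (p - q) q; rewrite subrK E => /esym/(canRL (addrK _)).
rewrite subrr /ratK => /eqP; rewrite mulf_eq0 invr_eq0 !intr_eq0_char0 (negPf (denq_neq0 _)) orbF.
by rewrite numq_eq0 subr_eq0 => /eqP.
Qed.

(** Compare top coefficients: differentiation multiplies them by the degrees [a] and [b], and [ratK]
    is injective. *)
Lemma deriv_cross_degree (p q : {poly K}) a b (s t : rat) :
  size p = a.+1 -> size q = b.+1 ->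
  p^`() * (ratK s *: q) = q^`() * (ratK t *: p) -> t * b%:R = s * a%:R.
Proof.
move=> sp sq E; apply: ratK_inj; rewrite !mulr_natr !ratKMn.
have szXd (u : {poly K}) k : size u = k.+1 -> (size ('X * u^`())%R <= k.+1)%N.
  move=> su; apply/leq_sizeP => -[|j] kj; rewrite coefXM //= coef_deriv nth_default ?mul0rn //.
  by rewrite su.
have coefXd (u : {poly K}) k : ('X * u^`())`_k = u`_k *+ k.
  by rewrite coefXM; case: k => //= k; rewrite coef_deriv.
(* The factor [X] restores the degree lost by differentiation, so constant [p] or [q] needs no
   separate case. *)
have := congr1 (fun u => ('X * u)`_(a + b)) E.
rewrite !mulrA coef_top ?szXd ?(leq_trans (size_scale_leq _ _)) ?sq // addnC.
rewrite coef_top ?szXd ?(leq_trans (size_scale_leq _ _)) ?sp //.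
rewrite !coefXd !coefZ.
have pa : p`_a != 0 by have := lead_coef_eq0 p; rewrite lead_coefE sp /= => ->; rewrite -size_poly_eq0 sp.
have qb : q`_b != 0 by have := lead_coef_eq0 q; rewrite lead_coefE sq /= => ->; rewrite -size_poly_eq0 sq.
move=> H; apply: (mulfI (mulf_neq0 pa qb)).
move: H; rewrite !(mulrnAl, mulrnAr) => H.
rewrite (_ : _ * _ * ratK t = q`_b * (ratK t * p`_a)); last by ring.
by rewrite -H; congr (_ *+ _); ring.
Qed.

End RatEmbedding.

(** * Derivations and the chain rule *)

Section ChainRule.
Variables (K : closedFieldType) (Q : comNzRingType) (phi : {rmorphism {poly K} -> Q}).
Variable D : Q -> Q.
Hypotheses (DD : {morph D : a b / a + b}) (DM : forall a b, D (a * b) = D a * b + a * D b).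
Hypothesis Dcst : forall c, D (phi c%:P) = 0.

Lemma derivation_poly (c : {poly K}) : D (phi c) = phi c^`() * D (phi 'X).
Proof.
elim/poly_ind: c => [|p a IH].
  by have := Dcst 0; rewrite polyC0 deriv0 !rmorph0 mul0r.
rewrite rmorphD rmorphM DD DM Dcst IH derivD derivM derivX derivC addr0 mulr1.
by rewrite addr0 rmorphD rmorphM; ring.
Qed.

(** Stated for any derivation killing constants, so that [d/dpi] and [t d/dt] are both instances. *)
Lemma chain_rule (h : {poly {poly K}}) s :
  D (map_poly phi h).[s] =
  (map_poly phi (dx h)).[s] * D (phi 'X) + (map_poly phi (dy h)).[s] * D s.
Proof.
have dxD (u v : {poly {poly K}}) : dx (u + v) = dx u + dx v.
  by apply/polyP => i; rewrite /dx coefD !coef_map_id0 ?deriv0 // coefD derivD.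
have dxX (u : {poly {poly K}}) : dx (u * 'X) = dx u * 'X.
  apply/polyP => i; rewrite /dx coefMX !coef_map_id0 ?deriv0 // !coefMX.
  by case: i => [|i] /=; rewrite ?deriv0 // coef_map_id0 ?deriv0.
have dxC (c : {poly K}) : dx c%:P = (c^`())%:P.
  apply/polyP => i; rewrite /dx coef_map_id0 ?deriv0 // !coefC.
  by case: ifP => _; rewrite ?deriv0.
elim/poly_ind: h => [|p a IH].
  rewrite [dx 0](dxC 0) deriv0 /dy deriv0 !rmorph0 !horner0 !mul0r addr0.
  by have := Dcst 0; rewrite polyC0 rmorph0.
rewrite dxD dxX dxC /dy derivD derivM derivX derivC addr0 mulr1 -/(dy p).
rewrite !rmorphD !rmorphM /= !map_polyX !map_polyC /= !hornerE DD DM IH (derivation_poly a).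
by ring.
Qed.

End ChainRule.

Section Jacobian.
Variable K : closedFieldType.
Hypothesis charK0 : [pchar K] =i pred0.
Implicit Types (alpha beta : puis K) (d : rat).

Local Notation lift := (puis_lift (@polyC K)).

Definition phiQ : {rmorphism {poly K} -> puis {poly K}} := lift \o xpuis K.

Definition trunc_puis alpha d : puis K :=
  @coef_map_puis K K (fun q c => if q < d then c else 0) (fun q => if_same _ _) alpha.

Definition sigma alpha d : puis {poly K} := lift (trunc_puis alpha d) + mono d 'X.

Lemma sigmaE alpha d : sigma alpha d = pi_ser (trunc alpha d, d) :> ser _.
Proof.
apply/funext => q; rewrite /sigma puisD puis_liftE monoE /pi_ser /trunc /=.
by case: (ltgtP q d) => _; rewrite ?addr0 ?polyC0 ?add0r.
Qed.

Definition dpi : puis {poly K} -> puis {poly K} :=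
  @coef_map_puis {poly K} {poly K} (fun _ c => c^`()) (fun _ => @deriv0 K).
(** The Euler derivation [t d/dt]; unlike [d/dt] it does not shift exponents. *)
Definition theta : puis {poly K} -> puis {poly K} :=
  @coef_map_puis {poly K} {poly K} (fun q c => ratK K q *: c) (fun q => scaler0 _ _).

Lemma dpiD : {morph dpi : a b / a + b}.
Proof. by move=> a b; apply: puis_ext => q; apply: derivD. Qed.
Lemma thetaD : {morph theta : a b / a + b}.
Proof. by move=> a b; apply: puis_ext => q; apply: scalerDr. Qed.
Lemma dpiM a b : dpi (a * b) = dpi a * b + a * dpi b.
Proof. by apply: coef_map_leibniz => [_ c d|_ _ c d]; [exact: derivD|exact: derivM]. Qed.
Lemma thetaM a b : theta (a * b) = theta a * b + a * theta b.
Proof.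
apply: coef_map_leibniz => [q c d|q r c d]; first exact: scalerDr.
by rewrite ratKD // scalerDl scalerAl scalerAr.
Qed.

Lemma phiQ_const c : phiQ c%:P = mono 0 c%:P.
Proof.
rewrite /phiQ /= /horner_eval /= map_polyC /= hornerC; exact: puis_lift_mono.
Qed.

Lemma phiQX : phiQ 'X = mono (-1) 1.
Proof.
rewrite /phiQ /= /horner_eval /= map_polyX hornerX puis_lift_mono.
by rewrite rmorph1.
Qed.

Lemma dpi_phiQ c : dpi (phiQ c) = 0.
Proof.
apply: puis_ext => q; change (((xpuis K c) q)%:P^`() = 0).
exact: derivC.
Qed.

Lemma theta_const c : theta (phiQ c%:P) = 0.
Proof.
rewrite phiQ_const; apply: puis_ext => q; rewrite /theta /= /smono.
by case: (q =P 0) => [->|_]; rewrite ?scaler0 // (ratK_int charK0 0) scale0r.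
Qed.

Lemma theta_X : theta (phiQ 'X) = - phiQ 'X.
Proof.
rewrite phiQX; apply: puis_ext => q; rewrite puisN monoE /theta /= /smono.
case: (q =P -1) => [->|_]; rewrite ?scaler0 ?oppr0 //.
by rewrite (ratK_int charK0 (-1)) scaleN1r.
Qed.

Lemma dpi_sigma alpha d : dpi (sigma alpha d) = mono d 1.
Proof.
apply: puis_ext => q; rewrite /dpi /= /sadd /smono.
by case: (q =P d) => _; rewrite derivD derivC ?derivX ?deriv0 add0r.
Qed.

Section Pair.
Variables (f g : {poly {poly K}}) (c : K).
Hypothesis jac : dx f * dy g - dy f * dx g = (c%:P)%:P.
Local Notation ev h s := (map_poly phiQ h).[s].

(** By the chain rule [dpi] sees only [y] and [theta x = -x]. The terms in [theta s] cancel, leaving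
    the Jacobian times [x dpi(s) = t^(d-1)]. *)
Lemma jacobian_sigma alpha d (s := sigma alpha d) :
  dpi (ev f s) * theta (ev g s) - dpi (ev g s) * theta (ev f s) = mono (d - 1) c%:P.
Proof.
have dpiC a : dpi (phiQ a%:P) = 0 by apply: dpi_phiQ.
rewrite !(chain_rule dpiD dpiM dpiC) !(chain_rule thetaD thetaM theta_const).
rewrite dpi_phiQ theta_X dpi_sigma !mulr0 !add0r.
have J : ev (dx f) s * ev (dy g) s - ev (dy f) s * ev (dx g) s = mono 0 c%:P.
  transitivity (ev (c%:P)%:P s); last by rewrite map_polyC hornerC; exact: phiQ_const.
  by rewrite -!hornerM -hornerN -hornerD -!rmorphM -rmorphB jac.
transitivity (phiQ 'X * mono d 1 * mono 0 c%:P); first by rewrite -J; ring.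
by rewrite phiQX !monoM mul1r addr0 addrC mul1r.
Qed.

(** The left side of [jacobian_sigma] starts at exponent [F + G] or later, the right side exactly at
    [d - 1]; below [d - 1] the coefficient must cancel. *)
Lemma jacobian_lead alpha d F G fs gs : c != 0 ->
  has_lead (ev f (sigma alpha d)) F fs -> has_lead (ev g (sigma alpha d)) G gs ->
  F + G <= d - 1 /\ (F + G < d - 1 -> fs^`() * (ratK K G *: gs) = gs^`() * (ratK K F *: fs)).
Proof.
move=> c0 Hf Hg.
have ldpi u q b : has_lead u q b -> has_lead (dpi u) q b^`().
  by move=> [h1 h2]; split=> [|r rq]; rewrite /dpi /= ?h1 // h2 // deriv0.
have ltheta u q b : has_lead u q b -> has_lead (theta u) q (ratK K q *: b).
  by move=> [h1 h2]; split=> [|r rq]; rewrite /theta /= ?h1 // h2 // scaler0.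
have [E1 L1] := has_leadM (ldpi _ _ _ Hf) (ltheta _ _ _ Hg).
have [E2 L2] := has_leadM (ldpi _ _ _ Hg) (ltheta _ _ _ Hf).
rewrite [G + F]addrC in E2 L2.
have J q := congr1 (fun s : puis {poly K} => s q) (jacobian_sigma alpha d).
split.
  rewrite leNgt; apply/negP => lt; have := J (d - 1).
  rewrite puisB L1 // L2 // subr0 monoE eqxx => /esym/eqP.
  by rewrite polyC_eq0 (negPf c0).
move=> lt; have := J (F + G).
rewrite puisB E1 E2 monoE lt_eqF // => /eqP.
by rewrite subr_eq0 => /eqP.
Qed.

End Pair.

(** The contact of [alpha] with itself is infinite; [D + 1] can stand for it because truncation
    orders never exceed [D + 1]. *)
Definition contact alpha D beta : rat :=
  if alpha == beta then D + 1 else sord (alpha - beta).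

Lemma sord_ge (R : comNzRingType) (s : puis R) e :
  s != 0 -> (forall q, q < e -> s q = 0) -> e <= sord s.
Proof.
move=> s0 H; have [nz _] := sord_lead s0.
by rewrite leNgt; apply: contra nz => /H ->.
Qed.

Lemma contact_lead alpha D beta d : d <= D + 1 -> d <= contact alpha D beta ->
  forall q, q < d -> (alpha - beta) q = 0.
Proof.
rewrite /contact; case: eqP => [-> _ _ q _|/eqP ne _ dv q qd]; first by rewrite subrr.
have := ne; rewrite -subr_eq0 => /sord_lead[_ [_ h]]; apply: h.
exact: lt_le_trans dv.
Qed.

Lemma sigma_subE alpha beta d q : (sigma alpha d - lift beta) q =
  (if q < d then (alpha q)%:P else 0) + (if q == d then 'X else 0) - (beta q)%:P.
Proof.
rewrite puisB puis_liftE /sigma puisD puis_liftE monoE /=.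
by case: ifP => // _; rewrite polyC0.
Qed.

(** If [beta] agrees with [alpha] below [d], the leading coefficient is [pi - beta_d]; otherwise it
    is the nonzero constant where they first differ. The size records which case occurs. *)
Lemma sigma_sub_lead alpha D beta d : d <= D + 1 ->
  exists C : {poly K}, has_lead (sigma alpha d - lift beta)
    (Num.min d (contact alpha D beta)) C /\ size C = (d <= contact alpha D beta)%R.+1.
Proof.
move=> dD; case: (leP d (contact alpha D beta)) => h.
  exists ('X - (beta d)%:P); split; last by rewrite size_XsubC.
  split=> [|q qd]; rewrite sigma_subE; first by rewrite ltxx eqxx add0r.
  rewrite qd lt_eqF // addr0 -polyCB -puisB.
  by rewrite (contact_lead dD h).
have ne : alpha - beta != 0.
  rewrite subr_eq0; apply: contraTneq h => ->; rewrite /contact eqxx.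
  by rewrite -leNgt.
have cE : contact alpha D beta = sord (alpha - beta).
  by rewrite /contact -subr_eq0 (negPf ne).
have [nz [_ l0]] := sord_lead ne; rewrite -cE in nz l0.
exists ((alpha - beta) (contact alpha D beta))%:P; split; last by rewrite size_polyC nz.
split=> [|q qd]; rewrite sigma_subE.
  by rewrite h lt_eqF // addr0 -polyCB.
by rewrite (lt_trans qd) // lt_eqF ?(lt_trans qd) // addr0 -polyCB -puisB l0.
Qed.

Lemma ev_sigma_lead (h : {poly {poly K}}) (rs : seq (puis K)) alpha D d :
  map_poly (xpuis K) h = \prod_(r <- rs) ('X - r%:P) -> d <= D + 1 ->
  exists C, has_lead (map_poly phiQ h).[sigma alpha d]
    (minsum (map (contact alpha D) rs) d) C /\
    size C = (nabove (map (contact alpha D) rs) d).+1.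
Proof.
move=> Eh dD; rewrite /phiQ map_poly_comp Eh rmorph_prod horner_prod {Eh}.
elim: rs => [|r rs [C [HC sC]]].
  exists 1; rewrite big_nil /minsum /= big_nil size_poly1; split=> //; exact: has_lead1.
have [C' [HC' sC']] := sigma_sub_lead alpha r dD.
exists (C' * C); rewrite big_cons /= minsum_cons rmorphB /= map_polyX map_polyC /= hornerXsubC.
split; first exact: has_leadM.
rewrite size_mul -?size_poly_eq0 ?sC ?sC' //.
by rewrite /nabove /= addnS.
Qed.

Lemma jacobian_contact (f g : {poly {poly K}}) c (fr gr : seq (puis K)) alpha D d
    (v := map (contact alpha D) fr) (w := map (contact alpha D) gr) :
  dx f * dy g - dy f * dx g = (c%:P)%:P -> c != 0 ->
  map_poly (xpuis K) f = \prod_(r <- fr) ('X - r%:P) ->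
  map_poly (xpuis K) g = \prod_(r <- gr) ('X - r%:P) -> d <= D + 1 ->
  minsum v d + minsum w d <= d - 1 /\
  (minsum v d + minsum w d < d - 1 ->
   minsum v d * (nabove w d)%:R = minsum w d * (nabove v d)%:R).
Proof.
move=> jac c0 Ef Eg dD.
have [fs [Hf sf]] := ev_sigma_lead alpha Ef dD.
have [gs [Hg sg]] := ev_sigma_lead alpha Eg dD.
have [J1 J2] := jacobian_lead jac c0 Hf Hg; split=> // lt.
exact: (deriv_cross_degree charK0 sf sg (J2 lt)).
Qed.

Lemma lambdaE (g : {poly {poly K}}) (gr : seq (puis K)) alpha D d :
  map_poly (xpuis K) g = \prod_(r <- gr) ('X - r%:P) -> d <= D + 1 ->
  lambda g (trunc alpha d, d) = minsum (map (contact alpha D) gr) d.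
Proof.
move=> Eg dD; rewrite /lambda -sigmaE sevalE -map_poly_comp.
have -> : map_poly (xpuis {poly K} \o map_poly polyC) g = map_poly phiQ g.
  by apply: eq_map_poly => a; rewrite /phiQ /= puis_lift_xpuis.
have [gs [Hg sg]] := ev_sigma_lead alpha Eg dD.
by apply: (has_lead_sord Hg); rewrite -size_poly_eq0 sg.
Qed.

End Jacobian.

(** * The intersection number *)

Lemma nonuniq_double_root (R : comNzRingType) (rs : seq R)
    (p := \prod_(r <- rs) ('X - r%:P)) :
  ~~ uniq rs -> exists r, p.[r] = 0 /\ p^`().[r] = 0.
Proof.
rewrite /p {p}; elim: rs => //= x rs IH; rewrite negb_and negbK big_cons derivM derivB derivX derivC subr0 mul1r.
case/orP => [xs|/IH[r [E1 E2]]]; last by exists r; rewrite !hornerE E1 E2 !mulr0 addr0.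
exists x; rewrite !hornerE subrr !mul0r addr0; split=> //.
by rewrite horner_prod (big_rem x) //= !hornerE subrr mul0r.
Qed.

(** Grouping a sum by the fibres of [h]. *)
Lemma sum_undup_map (T T' : eqType) (h : T -> T') (s : seq T) (F : T' -> rat) :
  \sum_(y <- undup (map h s)) (count (fun x => h x == y) s)%:R * F y =
  \sum_(x <- s) F (h x).
Proof.
under eq_bigr => y _ do rewrite -sum1_count natr_sum mulr_suml big_mkcond.
rewrite exchange_big /= !big_seq; apply: eq_bigr => x xs.
rewrite (bigD1_seq (h x)) ?undup_uniq ?mem_undup ?map_f //= eqxx mul1r.
by rewrite big1 ?addr0 // => y; rewrite eq_sym => /negPf->.
Qed.

Lemma scard_seq (T : choiceType) (l : seq T) : uniq l -> scard [set` l] = size l.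
Proof.
move=> ul; have -> : [set` l] = [set` [fset x in l]%fset].
  by apply/seteqP; split=> x /=; rewrite inE.
by rewrite /scard set_fsetK card_fseq undup_id.
Qed.

Lemma sordN (R : comNzRingType) (s : puis R) : sord (- s) = sord s.
Proof.
have [->|nz] := eqVneq s 0; first by rewrite oppr0.
have [h1 [_ h2]] := sord_lead nz.
apply: (@has_lead_sord _ _ _ (- s (sord s))); last by rewrite oppr_eq0.
by split=> // r rq; rewrite puisN h2 ?oppr0.
Qed.

(** Under [x = t^-1] the degree in [x] is minus the order in [t], which turns the intersection
    number into an order. *)
Lemma sord_xpuis (K : fieldType) (p : {poly K}) : p != 0 ->
  sord (xpuis K p) = - (size p).-1%:R.
Proof.
move=> nz.
have E (k : nat) : xpuis K p (- k%:R) = p`_k.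
  rewrite xpuisE /ser_of_xpoly rpredN natr_int oppr_le0 ler0n /=.
  by rewrite -(mulrNz 1 k) numq_int abszN.
apply: (@has_lead_sord _ _ _ (lead_coef p)); last by rewrite lead_coef_eq0.
split=> [|r rp]; first by rewrite E.
rewrite xpuisE /ser_of_xpoly; case: ifP => // /andP[/intrP[z Ez] _].
rewrite Ez numq_int nth_default //; move: rp; rewrite Ez.
case: z {Ez} => k.
  by rewrite -pmulrn ltNge (le_trans _ (ler0n _ _)) // oppr_le0 ler0n.
rewrite NegzE mulrNz ltrN2 -pmulrn ltr_nat abszN absz_nat.
by case: (size p).
Qed.

Section Separable.
Variable K : closedFieldType.
Hypothesis charK0 : [pchar K] =i pred0.

(** At a multiple root both [f] and [f_y] vanish; applying [t d/dt] to the relation [f = 0] there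
    makes [f_x] vanish too, so the Jacobian would be 0. *)
Lemma jacobian_simple_roots (f g : {poly {poly K}}) c (rs : seq (puis K)) :
  dx f * dy g - dy f * dx g = (c%:P)%:P -> c != 0 ->
  map_poly (xpuis K) f = \prod_(r <- rs) ('X - r%:P) -> uniq rs.
Proof.
move=> jac c0 Ef; apply/negPn/negP => /nonuniq_double_root[r []]; rewrite -Ef => r1 r2.
(* The root is moved to coefficients in [K[pi]], where [theta] is defined. *)
pose l := puis_lift (@polyC K).
have evE h : (map_poly (phiQ K) h).[l r] = l (map_poly (xpuis K) h).[r].
  by rewrite /phiQ map_poly_comp horner_map.
have l0 : l 0 = 0 by exact: rmorph0.
have fy0 : (map_poly (phiQ K) (dy f)).[l r] = 0.
  by rewrite evE /dy -deriv_map r2.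
have := chain_rule (thetaD (K:=K)) (thetaM charK0) (theta_const charK0) f (l r).
rewrite evE r1 l0 fy0 mul0r addr0 (theta_X charK0) phiQX.
have -> : theta (0 : puis {poly K}) = 0.
  by have := theta_const charK0 0; rewrite polyC0 rmorph0.
move=> /(congr1 (fun z => z * - mono 1 1)); rewrite mul0r -mulrA mulrNN monoM addNr mulr1.
rewrite [mono 0 1]/(1 : puis _) mulr1 => fx0.
have : (map_poly (phiQ K) (c%:P)%:P).[l r] = mono 0 c%:P.
  by rewrite map_polyC hornerC; exact: phiQ_const.
rewrite -jac rmorphB !rmorphM hornerD hornerN !hornerM -fx0 fy0 !mul0r subr0.
move=> /(congr1 (fun s : puis {poly K} => s 0)); rewrite monoE eqxx puis0E => /esym/eqP.
by rewrite polyC_eq0 (negPf c0).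
Qed.

End Separable.

(** * Orders at the roots of f and final pi-roots *)

Section Roots.
Variable K : closedFieldType.
Hypothesis charK0 : [pchar K] =i pred0.
Variables (f g : {poly {poly K}}) (c : K) (fr gr : seq (puis K)).
Hypotheses (jac : dx f * dy g - dy f * dx g = (c%:P)%:P) (c0 : c != 0).
Hypotheses (Ef : map_poly (xpuis K) f = \prod_(r <- fr) ('X - r%:P))
           (Eg : map_poly (xpuis K) g = \prod_(r <- gr) ('X - r%:P)).
Hypothesis gr0 : gr != [::].
(** Genericity of xi in the form used: a nonzero coefficient at [t^0] bounds the order of [f] at
    each root of [g] by 0. *)
Hypothesis generic : forall beta, beta \in gr -> (map_poly (xpuis K) f).[beta] 0 != 0.
Implicit Types alpha beta : puis K.

Local Notation delta alpha := (split_order g (pval alpha)).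
Local Notation fcontact alpha := (map (contact alpha (delta alpha)) fr).
Local Notation gcontact alpha := (map (contact alpha (delta alpha)) gr).
Definition gord alpha := minsum (gcontact alpha) (delta alpha).
Local Notation ford alpha := (minsum (fcontact alpha) (delta alpha)).

Lemma proot_f alpha : proot f alpha <-> alpha \in fr.
Proof. by rewrite proot_puis Ef root_prod_XsubC. Qed.

Lemma proot_g beta : proot g beta <-> beta \in gr.
Proof. by rewrite proot_puis Eg root_prod_XsubC. Qed.

Lemma no_common_root alpha beta : alpha \in fr -> beta \in gr -> alpha - beta != 0.
Proof.
move=> af bg; rewrite subr_eq0; apply/eqP => E; have := generic bg.
have /rootP -> : root (map_poly (xpuis K) f) beta by rewrite Ef root_prod_XsubC -E.
by rewrite puis0E eqxx.
Qed.

(** As [gr] is finite and nonempty, the maximum is attained and [split_order] is not its default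
    value. *)
Lemma split_orderP alpha : alpha \in fr ->
  (exists2 beta, beta \in gr & sord (alpha - beta) = delta alpha) /\
  {in gr, forall beta, sord (alpha - beta) <= delta alpha}.
Proof.
move=> af; have [|e] := @seq_maxP (map (fun b : puis K => sord (alpha - b)) gr).
  by rewrite -size_eq0 size_map size_eq0.
move=> /mapP[b bg ->] Hb; have -> : delta alpha = sord (alpha - b).
  apply: xget_unique.
    split; first by exists b; split=> //; apply/proot_g.
    by move=> b' /[dup] /proot_lift[u -> _] /proot_g ug; apply: (Hb _ (map_f _ ug)).
  move=> y [[b' [/[dup] /proot_lift[u -> _] /proot_g ug <-]] Hy]; apply: le_anti.
  by rewrite (Hb _ (map_f _ ug)) //=; apply: Hy; apply/proot_g.
by split=> [|b' bg']; [exists b|apply: Hb; apply: map_f].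
Qed.

Lemma contactE alpha beta D : alpha - beta != 0 -> contact alpha D beta = sord (alpha - beta).
Proof. by rewrite subr_eq0 /contact => /negPf->. Qed.

Lemma gcontactP alpha : alpha \in fr ->
  delta alpha \in gcontact alpha /\ {in gcontact alpha, forall x, x <= delta alpha}.
Proof.
move=> af; have [[b bg E] H] := split_orderP af; split.
  by apply/mapP; exists b; rewrite // contactE // no_common_root.
by move=> _ /mapP[b' bg' ->]; rewrite contactE ?no_common_root // H.
Qed.

Lemma fcontact_self alpha : alpha \in fr -> has (fun x => delta alpha + 1 <= x) (fcontact alpha).
Proof.
move=> af; apply/hasP; exists (delta alpha + 1) => //.
by apply/mapP; exists alpha => //; rewrite /contact eqxx.
Qed.

Lemma gordE alpha : alpha \in fr -> gord alpha = \sum_(b <- gr) sord (alpha - b).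
Proof.
move=> af; have [_ wD] := gcontactP af; rewrite /gord minsum_below // big_map.
by apply: eq_big_seq => b bg; rewrite contactE ?no_common_root.
Qed.

Lemma sord_g_root alpha : alpha \in fr -> sord (seval g alpha) = gord alpha.
Proof.
move=> af; rewrite sevalE Eg horner_prod gordE //.
apply: (@has_lead_sord _ _ _ (\prod_(b <- gr) (alpha - b) (sord (alpha - b)))).
  apply: has_lead_prod => b bg; rewrite hornerXsubC.
  by have [] := sord_lead (no_common_root af bg).
rewrite prodf_seq_neq0; apply/allP => b bg /=.
by have [] := sord_lead (no_common_root af bg).
Qed.

(** Let [b] be a root of [g] realizing the split order. For each root [a] of [f],
    [b - a = (alpha - a) - (alpha - b)] has order at least the summand of [a], so the sum is at most
    the order of [f] at [b], which is at most 0 by genericity. *)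
Lemma ford_le0 alpha : alpha \in fr -> ford alpha <= 0.
Proof.
move=> af; have [[b bg E] _] := split_orderP af.
have nz a : a \in fr -> b - a != 0.
  by move=> /no_common_root/(_ bg); rewrite -oppr_eq0 opprB.
have Hl : has_lead (map_poly (xpuis K) f).[b] (\sum_(a <- fr) sord (b - a))
    (\prod_(a <- fr) (b - a) (sord (b - a))).
  rewrite Ef horner_prod; apply: has_lead_prod => a aF; rewrite hornerXsubC.
  by have [] := sord_lead (nz a aF).
apply: (@le_trans _ _ (\sum_(a <- fr) sord (b - a))); last first.
  by rewrite leNgt; apply: contra (generic bg) => h; rewrite Hl.2.
rewrite /minsum big_map !big_seq; apply: ler_sum => a aF.
apply: sord_ge (nz a aF) _ => q; rewrite lt_min => /andP[qd qa].
have ab0 : (alpha - b) q = 0.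
  have [_ [_ h]] := sord_lead (no_common_root af bg).
  by apply: h; rewrite E.
have -> : b - a = (alpha - a) - (alpha - b) by ring.
rewrite puisB ab0 subr0; move: qa; rewrite /contact; case: eqP => [->|/eqP ne].
  by rewrite subrr.
by move=> qa; have := ne; rewrite -subr_eq0 => /sord_lead[_ [_ ->]].
Qed.

Lemma jac_le alpha D d : d <= D + 1 ->
  minsum (map (contact alpha D) fr) d + minsum (map (contact alpha D) gr) d <= d - 1.
Proof. by move=> dD; have [] := jacobian_contact charK0 alpha jac c0 Ef Eg dD. Qed.

Lemma jac_lt alpha D d (v := map (contact alpha D) fr) (w := map (contact alpha D) gr) :
  d <= D + 1 -> minsum v d + minsum w d < d - 1 ->
  minsum v d * (nabove w d)%:R = minsum w d * (nabove v d)%:R.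
Proof. by move=> dD; have [] := jacobian_contact charK0 alpha jac c0 Ef Eg dD. Qed.

Lemma order_proportional alpha : alpha \in fr ->
  (size gr)%:R * ford alpha = (size fr)%:R * gord alpha.
Proof.
move=> af; have [Dw wD] := gcontactP af.
have := contact_proportional (fcontact_self af) Dw (@jac_le _ _) (@jac_lt _ _) (ford_le0 af).
by rewrite !size_map.
Qed.

Lemma gord_le0 alpha : alpha \in fr -> gord alpha <= 0.
Proof.
move=> af; have fr0 : (0 : rat) < (size fr)%:R by rewrite ltr0n; case: (fr) af.
rewrite -(pmulr_rle0 _ fr0) -order_proportional //.
by rewrite mulr_ge0_le0 ?ler0n ?ford_le0.
Qed.

Lemma gord_major alpha : alpha \in fr -> gord alpha < 0 ->
  ford alpha + gord alpha = delta alpha - 1 /\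
  - gord alpha = (size gr)%:R / ((size fr)%:R + (size gr)%:R) * (1 - delta alpha).
Proof.
move=> af neg; have [Dw wD] := gcontactP af.
have E := contact_eq (fcontact_self af) wD (@jac_le _ _) (@jac_lt _ _) neg.
split=> //; have P := order_proportional af.
have fr0 : (0 : rat) < (size fr)%:R by rewrite ltr0n; case: (fr) af.
have mn : (size fr)%:R + (size gr)%:R != 0 :> rat.
  by rewrite lt0r_neq0 // ltr_wpDr // ler0n.
apply: (mulfI mn); rewrite mulrA mulrCA mulfV // mulr1.
move: E P; rewrite /gord; set F := minsum _ _; set G := minsum _ _ => E P.
have -> : 1 - delta alpha = - (F + G) by rewrite E opprB.
by rewrite mulrN mulrDl -P mulrN mulrDr.
Qed.

Lemma lambda_final alpha : lambda g (final_pi_root g alpha) = gord alpha.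
Proof. by apply: lambdaE Eg _; rewrite lerDl ler01. Qed.

(** Capped at [D], a contact order depends only on the terms below [t^D], and the stand-in values
    [D + 1] and [D' + 1] become invisible. *)
Lemma min_contact alpha alpha' D D' beta : D <= D' ->
  (forall q, q < D -> alpha' q = alpha q) ->
  Num.min D (contact alpha D beta) = Num.min D (contact alpha' D' beta).
Proof.
move=> DD' agree.
have small a E : D <= E -> (forall q, q < D -> (a - beta) q = 0) ->
    Num.min D (contact a E beta) = D.
  move=> DE h; apply/min_idPl; rewrite /contact; case: eqP => [_|/eqP ne].
    by rewrite (le_trans DE) // lerDl ler01.
  by apply: sord_ge h; rewrite subr_eq0.
have sub q : q < D -> (alpha' - beta) q = (alpha - beta) q.
  by move=> qD; rewrite !puisB agree.
have [h|/existsNP[q /not_implyP[qD /eqP nq]]] := EM (forall q, q < D -> (alpha - beta) q = 0).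
  by rewrite !small // => q qD; rewrite sub ?h.
have nz : alpha - beta != 0 by apply: contraNneq nq => ->.
have [n1 [_ l1]] := sord_lead nz.
have sD : sord (alpha - beta) < D.
  by apply: le_lt_trans qD; rewrite leNgt; apply: contra nq => h; rewrite l1.
have l' : has_lead (alpha' - beta) (sord (alpha - beta)) ((alpha - beta) (sord (alpha - beta))).
  split=> [|r rlt]; first by rewrite sub.
  by rewrite sub ?l1 // (lt_trans rlt).
have nz' : alpha' - beta != 0.
  apply: contraNneq n1 => z; have [<- _] := l'; by rewrite z.
by rewrite !contactE // (has_lead_sord l' n1).
Qed.

Lemma minsum_contact alpha alpha' D D' (rs : seq (puis K)) : D <= D' ->
  (forall q, q < D -> alpha' q = alpha q) ->
  minsum (map (contact alpha D) rs) D = minsum (map (contact alpha' D') rs) D.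
Proof.
by move=> DD' agree; rewrite /minsum !big_map; apply: eq_bigr => b _; exact: min_contact.
Qed.

(** If the split order of [alpha'] were larger, [contact_lt] for [alpha'] would make the inequality
    at [delta alpha] strict; but the sums there are those of [alpha], for which [gord_major] gives
    equality. *)
Lemma final_pi_root_agree alpha alpha' : alpha \in fr -> gord alpha < 0 -> alpha' \in fr ->
  (forall q, q < delta alpha -> alpha' q = alpha q) ->
  final_pi_root g alpha' = final_pi_root g alpha.
Proof.
move=> af neg af' agree.
have [[b bg Eb] _] := split_orderP af; have [_ H'] := split_orderP af'.
have DD' : delta alpha <= delta alpha'.
  apply: le_trans (H' b bg); apply: sord_ge; first exact: no_common_root.
  move=> q qD; rewrite puisB agree // -puisB.
  have [_ [_ h]] := sord_lead (no_common_root af bg).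
  by apply: h; rewrite Eb.
have [Dw' wD'] := gcontactP af'.
have E : delta alpha' = delta alpha.
  apply/eqP; rewrite eq_le DD' andbT leNgt; apply/negP => lt.
  have := contact_lt (fcontact_self af') Dw' (@jac_le alpha' _) lt.
  rewrite -!(minsum_contact _ DD' agree).
  by have [-> _] := gord_major af neg; rewrite ltxx.
rewrite /final_pi_root E; congr (_, _); apply/funext => q; rewrite /trunc.
by case: ifP => // /agree.
Qed.

Let fpr (a : puis K) : ser K * rat := final_pi_root g a.

(** The set attached to a final major pi-root is thus a fibre of [fpr], so its cardinality counts
    how often that pi-root arises. *)
Lemma Dset_final alpha : alpha \in fr -> gord alpha < 0 ->
  Dset f (final_pi_root g alpha) =
  [set` map (@pval K) [seq a <- fr | fpr a == fpr alpha]].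
Proof.
move=> af neg; set D := delta alpha.
have ordE (a : puis K) : sord (ssub (pi_ser (final_pi_root g alpha)) (fun q => (a q)%:P)) =
    sord (sigma alpha D - puis_lift (@polyC K) a).
  by congr sord; rewrite /final_pi_root -/D -sigmaE; apply/funext => q.
have lead_D (a : puis K) : (sigma alpha D - puis_lift (@polyC K) a) D = 'X - (a D)%:P.
  by rewrite sigma_subE ltxx eqxx add0r.
(* The coefficient at [D] is [pi - a_D], never zero; hence having order [D] means exactly agreement
   below [D]. *)
have XD_neq0 (a : puis K) : 'X - (a D)%:P != 0 by rewrite polyXsubC_eq0.
apply/seteqP; split=> a /=.
  move=> [/[dup] /proot_lift[u -> _] /proot_f uf]; rewrite ordE /= -/D => Eord.
  apply: map_f; rewrite mem_filter uf andbT; apply/eqP; apply: final_pi_root_agree => // q qD.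
  have nz : sigma alpha D - puis_lift (@polyC K) u != 0.
    by apply: contraNneq (XD_neq0 u) => z; rewrite -lead_D z.
  have [_ [_ h]] := sord_lead nz; rewrite Eord in h.
  have := h q qD; rewrite sigma_subE qD lt_eqF // addr0 -polyCB => /eqP.
  by rewrite polyC_eq0 subr_eq0 => /eqP.
move=> /mapP[u]; rewrite mem_filter => /andP[/eqP Eu uf] ->; split; first exact/proot_f.
rewrite ordE; change (sord (sigma alpha D - puis_lift (@polyC K) u) = D).
apply: (@has_lead_sord _ _ _ ('X - (u D)%:P)) => //.
split=> [|q qD]; first exact: lead_D.
have [/(congr1 (fun s => s q)) + ED] := Eu; rewrite /trunc ED -/D qD => Eq.
by rewrite sigma_subE qD lt_eqF // addr0 -polyCB Eq subrr.
Qed.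

Let majors := [seq a <- fr | gord a < 0].

Lemma PM_majors : PM f g = [set` undup (map fpr majors)].
Proof.
apply/seteqP; split=> sg /=; rewrite mem_undup.
  move=> [a [/[dup] /proot_lift[u -> _] /proot_f uf] + <-].
  by rewrite sord_g_root // => neg; apply: map_f; rewrite mem_filter neg.
move=> /mapP[u]; rewrite mem_filter => /andP[neg uf] ->.
exists u => //; split; first exact/proot_f.
by rewrite sord_g_root.
Qed.

Lemma uniq_fr : uniq fr.
Proof. exact: (jacobian_simple_roots charK0 jac c0 Ef). Qed.

(** Converts sums weighted by [|D_sigma|] into plain sums over the major roots; [uniq_fr] makes
    cardinalities agree with counts in the list. *)
Lemma sum_PM (F : ser K * rat -> rat) :
  \sum_(sg \in PM f g) (scard (Dset f sg))%:R * F sg = \sum_(a <- majors) F (fpr a).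
Proof.
rewrite PM_majors -(fsbig_seq _ _ (undup_uniq _)) -(sum_undup_map fpr).
apply: eq_big_seq => sg; rewrite mem_undup => /mapP[u]; rewrite mem_filter => /andP[neg uf] ->.
congr (_%:R * _); rewrite Dset_final // scard_seq ?size_map; last first.
  by rewrite map_inj_uniq ?filter_uniq ?uniq_fr //; apply: val_inj.
rewrite size_filter /majors count_filter; apply: eq_in_count => a aF /=.
(* A root sharing its final pi-root with a major one has the same [lambda], hence is major, so
   restricting to [majors] loses nothing. *)
rewrite -/(fpr a) -/(fpr u); case: eqP => //= E.
by rewrite -lambda_final -/(fpr a) E lambda_final.
Qed.

Hypotheses (mf : f \is monic) (mg : g \is monic).

(** By [gord_le0], a root that is not major contributes exactly 0. *)
Lemma sum_majors : \sum_(a <- fr) gord a = \sum_(a <- majors) gord a.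
Proof.
rewrite big_filter [RHS]big_mkcond; apply: eq_big_seq => a /gord_le0.
by rewrite le_eqVlt; case: ltP => //= _; rewrite orbF => /eqP.
Qed.

Lemma Iint_gord : (Iint f g)%:R = - \sum_(a <- majors) gord a.
Proof.
(* Swapping [f] and [g] only changes the sign of [c]; this gives the distinct roots of [g] that
   [resultant_prod_roots] requires. *)
have gjac : dx g * dy f - dy g * dx f = ((- c)%:P)%:P.
  by rewrite !polyCN -jac opprB mulrC [dy g * _]mulrC.
have ugr : uniq gr.
  by apply: (jacobian_simple_roots charK0 gjac _ Eg); rewrite oppr_eq0.
have nz a b : a \in fr -> b \in gr -> b - a != 0.
  by move=> af bg; rewrite -oppr_eq0 opprB no_common_root.
have one_neq0 (h : {poly {poly K}}) : h \is monic -> xpuis K (lead_coef h) != 0.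
  by move=> /monicP ->; rewrite rmorph1 oner_eq0.
have Eres : xpuis K (resultant f g) = \prod_(b <- gr) \prod_(a <- fr) (b - a).
  rewrite map_resultant ?one_neq0 // Eg resultant_prod_roots // Ef.
  by apply: eq_bigr => b _; rewrite horner_prod; apply: eq_bigr => a _; rewrite hornerXsubC.
pose C := \prod_(b <- gr) \prod_(a <- fr) (b - a) (sord (b - a)).
have C0 : C != 0.
  rewrite prodf_seq_neq0; apply/allP => b bg; apply/implyP => _.
  rewrite prodf_seq_neq0; apply/allP => a af; apply/implyP => _.
  by have [] := sord_lead (nz a b af bg).
have Hl : has_lead (xpuis K (resultant f g)) (\sum_(b <- gr) \sum_(a <- fr) sord (b - a)) C.
  rewrite Eres; apply: has_lead_prod => b bg; apply: has_lead_prod => a af.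
  by have [] := sord_lead (nz a b af bg).
have R0 : resultant f g != 0.
  by apply: contraNneq C0 => z; have [<- _] := Hl; rewrite z rmorph0.
rewrite -[LHS]opprK /Iint -(sord_xpuis R0) (has_lead_sord Hl C0) -sum_majors.
congr (- _); rewrite exchange_big; apply: eq_big_seq => a af; rewrite gordE //.
by apply: eq_bigr => b _; rewrite -sordN opprB.
Qed.

Lemma degy_roots (h : {poly {poly K}}) rs : h \is monic ->
  map_poly (xpuis K) h = \prod_(r <- rs) ('X - r%:P) -> degy h = size rs.
Proof.
move=> /monicP mh Eh; have := size_prod_XsubC rs id.
by rewrite -Eh size_map_poly_id0 /degy ?mh ?rmorph1 ?oner_eq0 // => ->.
Qed.

Lemma intersection_formula :
  (Iint f g)%:R = - \sum_(sg \in PM f g) (scard (Dset f sg))%:R * lambda g sg /\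
  - \sum_(sg \in PM f g) (scard (Dset f sg))%:R * lambda g sg =
  (degy g)%:R / ((degy f)%:R + (degy g)%:R) *
    \sum_(sg \in PM f g) (scard (Dset f sg))%:R * (1 - sg.2).
Proof.
rewrite (sum_PM (fun sg => lambda g sg)) (sum_PM (fun sg => 1 - sg.2)).
under eq_bigr => a _ do rewrite lambda_final.
split; first exact: Iint_gord.
rewrite (degy_roots mf Ef) (degy_roots mg Eg) mulr_sumr -sumrN.
apply: eq_big_seq => a; rewrite mem_filter => /andP[neg af].
by have [_] := gord_major af neg.
Qed.

End Roots.

Theorem theorem5p1 (K : closedFieldType) (charK0 : [pchar K] =i pred0)
  (f g : {poly {poly K}}) (Hfg : jacobian_pair f g) :
  exists S : seq K, forall xi : K, xi \notin S ->
    ((Iint (fxi f xi) g)%:R : rat)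
      = - \sum_(sg \in PM (fxi f xi) g) (scard (Dset (fxi f xi) sg))%:R * lambda g sg
    /\
    - \sum_(sg \in PM (fxi f xi) g) (scard (Dset (fxi f xi) sg))%:R * lambda g sg
      = ((degy g)%:R / ((degy f)%:R + (degy g)%:R))
        * \sum_(sg \in PM (fxi f xi) g) (scard (Dset (fxi f xi) sg))%:R * (1 - sg.2).
Proof.
have [mf [mg [c [c0 jac]]]] := Hfg.
have dC (a : {poly K}) : dx a%:P = (a^`())%:P.
  apply/polyP => i; rewrite /dx coef_map_id0 ?deriv0 // !coefC.
  by case: ifP => _; rewrite ?deriv0.
have d1 : dx (1 : {poly {poly K}}) = 0 by rewrite (dC 1) derivC.
have dy1 : dy (1 : {poly {poly K}}) = 0 by rewrite /dy -polyC1 derivC.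
(* A monic polynomial of degree 0 in [y] is 1 and has zero Jacobian. Positive degree lets
   subtraction of xi preserve monicity and degree of [f], and gives [g] at least one root. *)
have szf : (1 < size f)%N.
  rewrite ltnNge; apply: contra c0 => /(monic_size_le1 mf) E.
  by move/eqP: jac; rewrite E d1 dy1 !mul0r subrr eq_sym !polyC_eq0.
have szg : (1 < size g)%N.
  rewrite ltnNge; apply: contra c0 => /(monic_size_le1 mg) E.
  by move/eqP: jac; rewrite E d1 dy1 !mulr0 subrr eq_sym !polyC_eq0.
have [gr Eg] := puis_split charK0 (monic_map (xpuis K) mg).
(* The finitely many excluded values are the [t^0] coefficients of [f] at the roots of [g];
   subtracting any other xi leaves a nonzero constant term. *)
exists [seq (map_poly (xpuis K) f).[b] 0 | b : puis K <- gr] => xi xiS.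
have szxi : (size (- (xi%:P)%:P : {poly {poly K}}) < size f)%N.
  by rewrite size_polyN (leq_ltn_trans (size_polyC_leq1 _)).
have mfxi : fxi f xi \is monic by rewrite monicE /fxi lead_coefDl // (monicP mf).
have degfxi : degy (fxi f xi) = degy f by rewrite /degy /fxi size_polyDl.
have [fr Ef] := puis_split charK0 (monic_map (xpuis K) mfxi).
have jac' : dx (fxi f xi) * dy g - dy (fxi f xi) * dx g = (c%:P)%:P.
  rewrite -jac; congr (_ * _ - _ * _).
    apply/polyP => i; rewrite /dx !coef_map_id0 ?deriv0 // /fxi coefB derivB coefC.
    by case: ifP => _; rewrite ?derivC ?deriv0 subr0.
  by rewrite /dy /fxi derivB derivC subr0.
rewrite -degfxi; apply: (intersection_formula charK0 jac' c0 Ef Eg) => //.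
  by have := degy_roots mg Eg; rewrite /degy; case: (gr) szg => //=; case: (size g) => [|[]].
move=> b bg; apply: contra xiS => /eqP z; apply/mapP; exists b => //.
move: z; rewrite /fxi rmorphB hornerD hornerN.
have -> : (map_poly (xpuis K) (xi%:P)%:P).[b] = mono 0 xi.
  by rewrite map_polyC hornerC /xpuis /= /horner_eval /= map_polyC hornerC.
by rewrite puisB monoE eqxx => /eqP; rewrite subr_eq0 => /eqP.
Qed.
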